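(* Let $V$ be the set-valued return function of the finite-horizon multiobjective optimal control problem, $\phi$ the expanded set-valued map, and $\mathcal{H}$ the closed set, all described in the context. Then the epigraph of $V$ is equal to the viability kernel of $\mathcal{H}$ for $\phi$, i.e., $$\mathrm{Epi}(V) = \mathrm{Viab}_\phi(\mathcal{H}),$$ where $\mathrm{Epi}(V) = \mathrm{Graph}(V+\mathbf{R}^p_+) = \{(t,\mathbf{x},\mathbf{z}) : t\in I,\ \mathbf{x}\in\mathbf{R}^n,\ \mathbf{z}\in V(t,\mathbf{x})+\mathbf{R}^p_+\}$.
   Context: All norms on Euclidean spaces are supremum norms. Let $0<T<\infty$, $I=[0,T]$, and let $U\subset\mathbf{R}^m$ be nonempty and compact. Let $\mathbf{f}:\mathbf{R}^n\times U\to\mathbf{R}^n$ be continuous, with constants $K_{\mathbf{f}}>0$, $M_{\mathbf{f}}>0$ such that $\|\mathbf{f}(\mathbf{x}_1,\mathbf{u})-\mathbf{f}(\mathbf{x}_2,\mathbf{u})\|\le K_{\mathbf{f}}\|\mathbf{x}_1-\mathbf{x}_2\|$ and $\|\mathbf{f}(\mathbf{x},\mathbf{u})\|\le M_{\mathbf{f}}$ for all $\mathbf{x},\mathbf{x}_1,\mathbf{x}_2\in\mathbf{R}^n$, $\mathbf{u}\in U$. Let $\mathbf{L}:\mathbf{R}^n\times U\to\mathbf{R}^p$ be continuous, with constants $K_{\mathbf{L}}\ge0$, $M_{\mathbf{L}}\ge 0$ such that $\|\mathbf{L}(\mathbf{x}_1,\mathbf{u})-\mathbf{L}(\mathbf{x}_2,\mathbf{u})\|\le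 K_{\mathbf{L}}\|\mathbf{x}_1-\mathbf{x}_2\|$ and $\|\mathbf{L}(\mathbf{x},\mathbf{u})\|\le M_{\mathbf{L}}$ for all such $\mathbf{x},\mathbf{x}_1,\mathbf{x}_2,\mathbf{u}$. Controls: $\mathcal{U}$ is the set of bounded Lebesgue measurable functions $\mathbf{u}(\cdot):I\to U$. For $t\in I$, $\mathbf{x}\in\mathbf{R}^n$, $\mathbf{u}(\cdot)\in\mathcal{U}$, let $s\mapsto\mathbf{x}(s;t,\mathbf{x},\mathbf{u}(\cdot))$ be the unique solution of $\dot{\mathbf{x}}(s)=\mathbf{f}(\mathbf{x}(s),\mathbf{u}(s))$, $t\le s\le T$, $\mathbf{x}(t)=\mathbf{x}$. The cost is $\mathbf{J}(t,\mathbf{x},\mathbf{u}(\cdot))=\int_t^T\mathbf{L}(\mathbf{x}(s;t,\mathbf{x},\mathbf{u}(\cdot)),\mathbf{u}(s))\,\mathrm{d}s\in\mathbf{R}^p$, and the objective space is $Y(t,\mathbf{x})=\{\mathbf{J}(t,\mathbf{x},\mathbf{u}(\cdot)):\mathbf{u}(\cdot)\in\mathcal{U}\}$. Pareto optimality: for nonempty $S\subset\mathbf{R}^p$, $\mathcal{E}(S)$ is the set of $\mathbf{y}_1\in S$ for which there is no $\mathbf{y}_2\in S$, $\mathbf{y}_2\ne\mathbf{y}_1$, with $\mathbf{y}_1\in\mathbf{y}_2+\mathbf{R}^p_+$. The set-valued return function is $V(t,\mathbf{x})=\mathcal{E}(\mathrm{cl}(Y(t,\mathbf{x})))$ for $t\in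 I$, $\mathbf{x}\in\mathbf{R}^n$. Expanded dynamics: $\mathrm{FL}^-(\mathbf{x})=\overline{\mathrm{co}}\big(\bigcup_{\mathbf{u}\in U}\{(\mathbf{f}(\mathbf{x},\mathbf{u}),-\mathbf{L}(\mathbf{x},\mathbf{u}))\}\big)\subset\mathbf{R}^n\times\mathbf{R}^p$, where $\overline{\mathrm{co}}$ denotes the closure of the convex hull. The set-valued map $\phi$ from $\mathbf{R}\times\mathbf{R}^n\times\mathbf{R}^p$ to itself is $$\phi(t,\mathbf{x},\mathbf{z})=\begin{cases}\{1\}\times\mathrm{FL}^-(\mathbf{x}) & \text{if } t<T,\\ [0,1]\times\overline{\mathrm{co}}(\mathrm{FL}^-(\mathbf{x})\cup\{(\mathbf{0},\mathbf{0})\}) & \text{if } t\ge T.\end{cases}$$ The closed set is $\mathcal{H}=\{(t,\mathbf{x},\mathbf{z}) : t\in[0,T],\ \mathbf{x}\in\mathbf{R}^n,\ \mathbf{z}\in\{-(T-t)M_{\mathbf{L}}\mathbf{1}\}+\mathbf{R}^p_+\}$, where $\mathbf{1}=(1,\dots,1)\in\mathbf{R}^p$. $\mathrm{Viab}_\phi(\mathcal{H})$ is the set of points $(t,\mathbf{x},\mathbf{z})\in\mathcal{H}$ for which there exists an absolutely continuous solution $(t(\cdot),\mathbf{x}(\cdot),\mathbf{z}(\cdot))$ on $[0,\infty)$ of $(\dot t(s),\dot{\mathbf{x}}(s),\dot{\mathbf{z}}(s))\in\phi(t(s),\mathbf{x}(s),\mathbf{z}(s))$ for a.e. $s\ge0$,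 starting from $(t,\mathbf{x},\mathbf{z})$ at $s=0$ and satisfying $(t(s),\mathbf{x}(s),\mathbf{z}(s))\in\mathcal{H}$ for all $s\ge 0$. *)

(* Defs.v *)
From HB Require Import structures.
From mathcomp Require Import all_boot all_order all_algebra.
From mathcomp Require Import all_classical all_reals all_analysis.

Set Implicit Arguments.
Unset Strict Implicit.
Unset Printing Implicit Defensive.

Import Order.TTheory GRing.Theory Num.Theory.
Import numFieldNormedType.Exports.

Local Open Scope classical_set_scope.
Local Open Scope ring_scope.

(* R^n is 'rV[R]_n; its library norm is the supremum norm [mx_norm]. *)

Section Generic.
Variable R : realType.

(* R with the Caratheodory sigma-algebra of the Lebesgue outer measure, i.e.
   the Lebesgue measurable (not merely Borel) sets; it carries
   [completed_lebesgue_measure]. *)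
Definition lebesgueR := caratheodory_type (@wlength R idfun)^*%mu.

(* Target space with its Borel sigma-algebra. *)
Definition borel_rV (m : nat) := g_sigma_algebraType (@open 'rV[R]_m).

Definition lebesgue_measurable_fun (m : nat) (D : set R) (u : R -> 'rV[R]_m) :=
  measurable_fun (D : set lebesgueR) (u : lebesgueR -> borel_rV m).

Definition absolutely_continuous (E : normedModType R) (a b : R)
    (w : R -> E) : Prop :=
  forall e : R, 0 < e -> exists2 d : R, 0 < d &
    forall (k : nat) (l r : 'I_k -> R),
      (forall i, a <= l i /\ l i <= r i /\ r i <= b) ->
      trivIset setT (fun i => `]l i, r i[%classic) ->
      \sum_(i < k) (r i - l i) < d ->
      \sum_(i < k) `|w (r i) - w (l i)| < e.

Definition convex_hull (M : lmodType R) (A : set M) : set M :=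
  smallest (@convex_set R M) A.

Definition closed_convex_hull (E : normedModType R) (A : set E) : set E :=
  closure (convex_hull A).

(* On the half-line, absolute continuity means absolute continuity on every
   compact interval [0, b]. *)
Definition viability_kernel (E : normedModType R) (phi : E -> set E)
    (K : set E) : set E :=
  [set y | K y /\ exists w : R -> E,
     [/\ w 0 = y,
         (forall b : R, 0 <= b -> absolutely_continuous 0 b w),
         {ae @lebesgue_measure R, forall s : R, 0 <= s ->
            exists2 v : E, is_derive s 1 w v & phi (w s) v} &
         forall s : R, 0 <= s -> K (w s)]].

Definition orthant (p : nat) : set 'rV[R]_p :=
  [set w | forall j, 0 <= w ord0 j].

Definition pareto (p : nat) (S : set 'rV[R]_p) : set 'rV[R]_p :=
  [set y1 | S y1 /\
    ~ exists y2, [/\ S y2, y2 <> y1 & [set y2 + w | w in @orthant p] y1]].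

End Generic.

Section ControlProblem.
Variables (R : realType) (n m p : nat).
Variables (T : R) (U : set 'rV[R]_m).
Variables (f : 'rV[R]_n -> 'rV[R]_m -> 'rV[R]_n).
Variables (L : 'rV[R]_n -> 'rV[R]_m -> 'rV[R]_p).

(* Values of a control outside [0, T] are irrelevant. *)
Definition controls : set (R -> 'rV[R]_m) :=
  [set u | [/\ (forall s, `[0, T]%classic s -> U (u s)),
               [bounded u s | s in `[0, T]%classic] &
               lebesgue_measurable_fun `[0, T]%classic u]].

(* Caratheodory solutions on [t, T]; the two-sided derivative is used, which
   only matters at the endpoints. *)
Definition is_trajectory (t : R) (x : 'rV[R]_n) (u : R -> 'rV[R]_m)
    (y : R -> 'rV[R]_n) : Prop :=
  [/\ y t = x,
      absolutely_continuous t T y &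
      {ae @lebesgue_measure R, forall s : R, `[t, T]%classic s ->
         is_derive s 1 y (f (y s) (u s))}].

(* [xget] picks a solution when there is one; solutions exist and agree on
   [t, T] under the standing assumptions on f. *)
Definition trajectory (t : R) (x : 'rV[R]_n) (u : R -> 'rV[R]_m) :
    R -> 'rV[R]_n :=
  xget (cst x) [set y | is_trajectory t x u y].

Definition cost (t : R) (x : 'rV[R]_n) (u : R -> 'rV[R]_m) : 'rV[R]_p :=
  \row_j (\int[@completed_lebesgue_measure R]_(s in `[t, T]%classic)
            L (trajectory t x u s) (u s) ord0 j).

Definition objective_space (t : R) (x : 'rV[R]_n) : set 'rV[R]_p :=
  [set cost t x u | u in controls].

Definition return_function (t : R) (x : 'rV[R]_n) : set 'rV[R]_p :=
  pareto (closure (objective_space t x)).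

Definition epi_return : set (R * ('rV[R]_n * 'rV[R]_p)) :=
  [set y | `[0, T]%classic y.1 /\
     [set v + w | v in return_function y.1 y.2.1 & w in @orthant R p] y.2.2].

Definition FLminus (x : 'rV[R]_n) : set ('rV[R]_n * 'rV[R]_p) :=
  closed_convex_hull (\bigcup_(u in U) [set (f x u, - L x u)]).

Definition expanded_map (y : R * ('rV[R]_n * 'rV[R]_p)) :
    set (R * ('rV[R]_n * 'rV[R]_p)) :=
  if y.1 < T then [set 1] `*` FLminus y.2.1
  else `[0, 1]%classic `*` closed_convex_hull (FLminus y.2.1 `|` [set (0, 0)]).

Definition constraint_set (ML : R) : set (R * ('rV[R]_n * 'rV[R]_p)) :=
  [set y | `[0, T]%classic y.1 /\
     [set - ((T - y.1) * ML) *: const_mx 1 + w | w in @orthant R p] y.2.2].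

End ControlProblem.

(* Main.v *)
Require Import Defs.
From HB Require Import structures.
From mathcomp Require Import all_boot all_order all_algebra.
From mathcomp Require Import all_classical all_reals all_analysis.
From mathcomp Require Import measurable_realfun ring lra.
Import Order.TTheory GRing.Theory Num.Theory.
Import numFieldNormedType.Exports.
Local Open Scope classical_set_scope.
Local Open Scope ring_scope.

Set Implicit Arguments.
Unset Strict Implicit.
Unset Printing Implicit Defensive.

(** Why the epigraph is the viability kernel.

    Carry the cost along with the state: to a control [u], its trajectory [y] and a
    vector [z], associate the curve [(y, z - running cost)], which solves a
    differential equation driven by the field [(f, - L)]. Its second component ends
    at [z] minus the total cost, so [z] lies above the cost of [u] exactly when that
    component ends in the orthant. The map [expanded_map] is the convexification of
    this field, together with a clock that may stop at time [T] and not before.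
    Hence a viable curve is a solution of the convexified (relaxed) inclusion from
    [t] to [T] whose second component ends in the orthant. Conversely such a
    solution, stopped at [T], is viable: the lower boundary of the constraint set
    rises at the rate [ML], and the second component of a curve cannot fall faster.

    The theorem thus compares relaxed solutions with the closure of the set of
    costs. Two facts do this.

    Relaxation ([relaxation]): a relaxed solution is approximated by trajectories
    of controls. On a short interval its average velocity is near the convex hull
    of the velocities at the initial state ([mean_value]), and switching between
    constant controls realises any element of that hull ([average_of_hull]). The
    errors of successive short steps accumulate as in Euler's method.

    Compactness ([solutions_compact]): trajectories of controls have limits, taken
    pointwise along an ultrafilter, and such limits are relaxed solutions
    ([ulim_velocity]). They are Lipschitz, hence differentiable almost everywhere
    ([lipschitz_ae_derivable], by Radon-Nikodym and Lebesgue differentiation).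

    So the viable values are the sums [v + w] with [v] in the closure of the costs
    and [w] in the orthant. That closure is compact, so that each of its points lies
    above an efficient one ([pareto_below]), and [v] may be taken in the return
    function.

    The same mean value theorem carries all the estimates: an absolutely
    continuous curve whose derivative lies almost everywhere in a closed convex set
    has its mean velocity in that set. It is proved by Cousin's lemma on gauge
    partitions, in any normed space. Trajectories for measurable controls come from
    Picard iteration ([caratheodory_existence]), where the integrals of Lebesgue
    measurable functions are differentiated by passing to a Borel modification
    ([lebesgue_FTC]). *)

(** * Derivatives as first-order estimates *)

Section Derivatives.
Context {R : realType}.
Implicit Types E F : normedModType R.

(** The estimate form of differentiability: unlike the limit of difference
    quotients, it transfers to pairs, to components and to restrictions by mere
    comparison of norms. *)
Definition has_deriv E (w : R -> E) (s : R) (v : E) := forall e : R, 0 < e ->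
  exists2 d : R, 0 < d &
    forall h : R, `|h| < d -> `|w (s + h) - w s - h *: v| <= e * `|h|.

Lemma has_derivP E (w : R -> E) (s : R) (v : E) : is_derive s 1 w v <-> has_deriv w s v.
Proof.
split=> [[dw <-]|hw].
  move=> e e0.
  have /cvgr_distC_lt/(_ _ e0) : h^-1 *: (w (h *: 1 + s) - w s) @[h --> 0^'] -->
      'D_1 w s by exact: dw.
  move=> -[d /= d0 dP]; exists d => // h hd.
  have [->|h0] := eqVneq h 0.
    by rewrite addr0 subrr scale0r subrr !normr0 mulr0.
  have := dP h; rewrite /ball_/= sub0r normrN => /(_ hd h0).
  rewrite [h *: 1]mulr1 [h + s]addrC => /ltW k.
  have -> : w (s + h) - w s - h *: 'D_1 w s =
      h *: (h^-1 *: (w (s + h) - w s) - 'D_1 w s).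
    by rewrite scalerBr scalerA mulfV// scale1r.
  by rewrite normrZ mulrC ler_wpM2r.
have cv : h^-1 *: (w (h *: 1 + s) - w s) @[h --> 0^'] --> v.
  apply/cvgrPdist_le => e e0.
  have [d d0 dP] := hw _ e0.
  exists d => // h; rewrite /ball_/= sub0r normrN => hd h0.
  have := dP _ hd.
  rewrite [h *: 1]mulr1 [h + s]addrC distrC => k.
  have -> : v - h^-1 *: (w (s + h) - w s) = h^-1 *: (h *: v - (w (s + h) - w s)).
    by rewrite [RHS]scalerBr scalerA mulVf// scale1r.
  by rewrite normrZ normfV mulrC ler_pdivrMr ?normr_gt0// distrC.
split; first by apply/cvg_ex; exists v.
by apply: cvg_lim cv; exact: norm_hausdorff.
Qed.

Lemma closure_normP E (A : set E) (x : E) : closure A x <->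
  forall e : R, 0 < e -> exists2 y, A y & `|x - y| < e.
Proof.
split=> [cA e e0|H B /nbhs_ballP[e /= e0 eB]].
  have [y [Ay]] := cA _ (nbhsx_ballx x e e0).
  by rewrite -ball_normE; exists y.
by have [y Ay xy] := H _ e0; exists y; split => //; apply: eB; rewrite -ball_normE.
Qed.

End Derivatives.

(** * Gauge partitions *)

Section Cousin.
Context {R : realType}.

(** Cousin's lemma, phrased for any property of intervals that is stable under
    concatenation: the supremum of the points reachable from [a] is reachable,
    and it cannot be smaller than [b] since its own gauge leads beyond it. *)
Lemma cousin (P : R -> R -> Prop) (a b : R) : a <= b ->
  (forall l m r, l <= m <= r -> P l m -> P m r -> P l r) ->
  (forall s, a <= s <= b -> exists2 d : R, 0 < d &
     forall l r, a <= l -> l <= s <= r -> r <= b -> s - d < l -> r < s + d ->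
       P l r) ->
  P a b.
Proof.
move=> ab Pcat Ploc.
pose S := [set x | a <= x <= b /\ P a x].
have Sa : S a.
  split; first by rewrite lexx.
  have [d d0 Pd] := Ploc a (introT andP (conj (lexx a) ab)).
  by apply: Pd; rewrite ?lexx//; lra.
have Sub : ubound S b by move=> x [/andP[]].
have hS : has_sup S by split; [exists a|exists b].
pose c := sup S.
have ac : a <= c by exact: ub_le_sup (hS.2) _ Sa.
have cb : c <= b by apply: ge_sup => //; exists a.
have [d d0 Pd] := Ploc c (introT andP (conj ac cb)).
have [x [/andP[ax xb] Px] xc] := sup_adherent d0 hS.
have xc' : x <= c by apply: ub_le_sup (hS.2) _ _; split => //; apply/andP.
have Pr r : c <= r -> r <= b -> r < c + d -> P a r.
  move=> cr rb rd; apply: (Pcat _ x) => //; first by rewrite ax (le_trans xc').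
  by apply: Pd => //; rewrite xc' cr.
have [cltb|bc] := ltP c b; last first.
  by apply: Pr => //; move: d0 bc; lra.
pose r := Num.min b (c + d / 2).
have cr : c < r by rewrite /r lt_min cltb; move: d0; lra.
have rb : r <= b by rewrite /r ge_min lexx.
have Sr : S r.
  split; first by rewrite rb (le_trans ac (ltW cr)).
  apply: Pr => //; first exact: ltW.
  apply: (@le_lt_trans _ _ (c + d / 2)); last by move: d0; lra.
  by rewrite /r ge_min lexx orbT.
by have := ub_le_sup hS.2 Sr; rewrite leNgt -/c cr.
Qed.

End Cousin.

Section Chains.
Context {R : realType}.
Notation mu := (@lebesgue_measure R).

(** Non-overlapping intervals listed from left to right. The recursion makes
    concatenation and the summation of lengths immediate, which an indexed family
    of disjoint intervals would not. *)
Fixpoint chain (l r : R) (B : seq (R * R)) : Prop :=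
  if B is x :: B' then [/\ l <= x.1, x.1 <= x.2 & chain x.2 r B'] else l <= r.

Lemma chain_le l r B : chain l r B -> l <= r.
Proof.
elim: B l => //= x B IH l [lx xx /IH]; lra.
Qed.

Lemma chain_cat l m r B1 B2 :
  chain l m B1 -> chain m r B2 -> chain l r (B1 ++ B2).
Proof.
elim: B1 l => /= [l lm|x B IH l [lx xx c1] c2]; last by split => //; exact: IH.
case: B2 => /= [mr|x B2 [mx xx c]]; first exact: le_trans lm mr.
by split => //; exact: le_trans lm mx.
Qed.

Lemma chain_bounds l r B x0 i : chain l r B -> (i < size B)%N ->
  [/\ l <= (nth x0 B i).1, (nth x0 B i).1 <= (nth x0 B i).2 &
      (nth x0 B i).2 <= r].
Proof.
elim: B l i => //= x B IH l [|i] [lx xx c] /=.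
  by have := chain_le c.
rewrite ltnS.
by move=> /(IH _ _ c)[h1 h2 h3]; split => //=; lra.
Qed.

Lemma chain_ordered l r B x0 i j : chain l r B -> (i < j < size B)%N ->
  (nth x0 B i).2 <= (nth x0 B j).1.
Proof.
elim: B l i j => //= [|x B IH] l i j; first by rewrite ltn0 andbF.
case: j => [|j]//; rewrite !ltnS => -[lx xx c] /andP[ij jB].
case: i ij => [_|i ij] /=; first by have [] := chain_bounds x0 c jB.
by apply: IH c _; rewrite jB ij.
Qed.

(** Peeling off the leftmost interval, additivity of the measure bounds the
    total length of a chain by the measure of any set that contains it. *)
Lemma chain_measure l r B (O : set R) : measurable (O : set (measurableTypeR R)) ->
  chain l r B -> (forall x, x \in B -> `[x.1, x.2] `<=` O) ->
  ((\sum_(x <- B) (x.2 - x.1))%:E <= mu (O `&` `]l, r]))%E.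
Proof.
move=> mO; elim: B l => [l _ _|x B IH l [lx xx c] BO].
  by rewrite big_nil.
rewrite big_cons EFinD.
have mi (p q : R) : measurable (O `&` `]p, q]) by apply: measurableI.
apply: (@le_trans _ _ (mu (`]x.1, x.2]) + mu (O `&` `]x.2, r]))%E).
  apply: leeD; last by apply: IH c _ => y yB; apply: BO; rewrite inE yB orbT.
  by rewrite lebesgue_measure_itv/= lte_fin; case: ltP => // h; rewrite lee_fin; lra.
rewrite -measureU; [|exact: measurable_itv|exact: mi|]; last first.
  rewrite -subset0 => y [] /=; rewrite !in_itv/= => /andP[_ h1] [_ /andP[h2 _]].
  by move: h1 h2; lra.
apply: le_measure; rewrite ?inE//; first by apply: measurableU; [exact: measurable_itv|exact: mi].
  exact: mi.
move=> y [h|[Oy h]].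
  split; first by apply: (BO x); rewrite ?mem_head//= in_itv/=; move: h => /=; rewrite in_itv/= => /andP[/ltW -> ->].
  move: h (chain_le c) => /=; rewrite !in_itv/= => /andP[h1 h2] h3.
  by rewrite (le_lt_trans lx h1) (le_trans h2 h3).
split => //; move: h => /=; rewrite !in_itv/= => /andP[h1 ->].
by rewrite andbT; lra.
Qed.

Lemma chain_ac (E : normedModType R) (w : R -> E) a b (e : R) :
  absolutely_continuous a b w -> 0 < e ->
  exists2 d : R, 0 < d & forall B, chain a b B ->
    \sum_(x <- B) (x.2 - x.1) < d -> \sum_(x <- B) `|w x.2 - w x.1| < e.
Proof.
move=> wac e0; have [d d0 wd] := wac _ e0; exists d => // B cB.
rewrite (big_nth (0,0)) big_mkord => Bd.
rewrite (big_nth (0,0)) big_mkord.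
apply: (wd _ (fun i : 'I_(size B) => (nth (0,0) B i).1)) => //.
  by move=> i; have [] := chain_bounds (0,0) cB (ltn_ord i).
apply/trivIsetP => i j _ _ ij; rewrite -subset0 => y [] /=.
wlog : i j ij / (i < j)%N.
  move=> H; have [h|h] := ltnP i j; first exact: H.
  move=> yi yj; apply: (H j i) => //; first by rewrite eq_sym.
  by rewrite ltn_neqAle h andbT eq_sym.
move=> ltij; rewrite !in_itv/= => /andP[_ h1] /andP[h2 _].
have := @chain_ordered _ _ _ (0,0) i j cB; rewrite ltij ltn_ord => /(_ isT).
by move: h1 h2; lra.
Qed.

End Chains.

(** * A mean value theorem for absolutely continuous curves *)

Section MeanValue.
Context {R : realType}.
Notation mu := (@lebesgue_measure R).

Definition cvx (M : lmodType R) (C : set M) := forall x y (k : R),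
  C x -> C y -> 0 <= k <= 1 -> C (k *: x + (1 - k) *: y).

Lemma convex_setP (M : lmodType R) (C : set M) : convex_set C <-> cvx C.
Proof.
split=> [cC x y k Cx Cy k01|cC x y k]; last first.
  rewrite !inE => Cx Cy.
  by apply: (cC x y k%:num Cx Cy); rewrite ge0 le1.
case/andP: k01 => k0 k1.
by have := cC x y (Itv01 k0 k1); rewrite !inE; apply.
Qed.

Lemma null_set_open_cover (N : set R) (e : R) : mu.-negligible N -> 0 < e ->
  exists O, [/\ open O, N `<=` O & (mu O <= e%:E)%E].
Proof.
move=> /negligible_outer_measure N0 e0.
have [G [oG NG]] := outer_measure_open_le N e0.
by rewrite N0 add0e; exists G.
Qed.

Lemma negligible_pair (a b : R) : mu.-negligible [set a; b].
Proof.
by apply: negligibleU; [exists [set a]|exists [set b]]; split => //;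
  exact: lebesgue_measure_set1.
Qed.

Variable (E : normedModType R).
Implicit Types (w : R -> E) (C : set E).

(** Every point of differentiability carries a gauge on which [w] follows its
    derivative up to a slope [e]; every other point carries a gauge inside an open
    set of small measure. A partition subordinate to these gauges splits the
    increment of [w] into a part that is a multiple of a convex combination of
    derivatives and a part that runs over a chain of small total length, which is
    negligible by absolute continuity. *)
Lemma mean_value_approx w (a b : R) C (e : R) : a <= b -> 0 < e ->
  absolutely_continuous a b w -> cvx C -> C !=set0 ->
  {ae mu, forall s, a < s < b -> exists2 v, has_deriv w s v & C v} ->
  exists2 c, C c & `|w b - w a - (b - a) *: c| <= (b - a) * e + e.
Proof.
move=> ab e0 wac cC [c0 C0] aeN.
have [d d0 dP] := chain_ac wac (divr_gt0 e0 (ltr0n _ 2)).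
(* Two demands on the measure of the bad set: below [d] for absolute continuity,
   and small enough for the filler [c0] that stands for the missing velocities. *)
pose eta := Num.min (d / 2) (e / 2 / (1 + `|c0|)).
have c1 : 0 < 1 + `|c0| by rewrite ltr_pwDl.
have eta0 : 0 < eta by rewrite lt_min !divr_gt0.
have [ O [oO NO muO]] := null_set_open_cover (negligibleU aeN (negligible_pair a b)) eta0.
(* [g] is the total length of the good intervals, [S] their contribution to the
   increment, and [B] the chain of the bad intervals. *)
pose P l r := exists (g : R) S B, [/\ 0 <= g, exists2 c, C c & S = g *: c,
  chain l r B /\ (forall x, x \in B -> `[x.1, x.2] `<=` O),
  g + \sum_(x <- B) (x.2 - x.1) = r - l &
  `|w r - w l - S| <= e * g + \sum_(x <- B) `|w x.2 - w x.1|].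
have Pab : P a b.
  apply: cousin => // [l m r _|s /andP[as_ sb]].
    move=> [g1 [S1 [B1 [g10 [x1 Cx1 S1E] [cB1 B1O] B1E w1]]]].
    move=> [g2 [S2 [B2 [g20 [x2 Cx2 S2E] [cB2 B2O] B2E w2]]]].
    exists (g1 + g2), (S1 + S2), (B1 ++ B2); split.
    - exact: addr_ge0.
    - have [g0|g0] := eqVneq (g1 + g2) 0.
        have [g1z g2z] : g1 = 0 /\ g2 = 0 by lra.
        by exists c0; rewrite // S1E S2E g1z g2z addr0 !scale0r addr0.
      exists ((g1 / (g1 + g2)) *: x1 + (1 - g1 / (g1 + g2)) *: x2).
        apply: cC => //; rewrite divr_ge0 ?addr_ge0//= ler_pdivrMr; first lra.
        by rewrite lt_neqAle eq_sym g0 addr_ge0.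
      rewrite scalerDr !scalerA S1E S2E; congr (_ *: _ + _ *: _); by field.
    - split; first exact: chain_cat cB1 cB2.
      by move=> x; rewrite mem_cat => /orP[/B1O|/B2O].
    - by rewrite big_cat/=; lra.
    - rewrite big_cat/=.
      have -> : w r - w l - (S1 + S2) = (w r - w m - S2) + (w m - w l - S1).
        by rewrite addrACA -opprD [S2 + _]addrC; congr (_ - _); rewrite addrA subrK.
      apply: le_trans (ler_normD _ _) _; lra.
  have [[v wv Cv]|Ns] := pselect (exists2 v, has_deriv w s v & C v).
    have [d1 d10 dP1] := wv _ e0.
    exists d1 => // l r al /andP[ls sr] rb sl rs.
    exists (r - l), ((r - l) *: v), [::]; split; rewrite ?big_nil//; try lra.
    - by exists v.
    - by split => //=; lra.
    - have -> : w r - w l - (r - l) *: v =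
          (w (s + (r - s)) - w s - (r - s) *: v) -
          (w (s + (l - s)) - w s - (l - s) *: v).
        rewrite !(addrC s) !subrK opprB [X in _ = _ + X]addrC addrACA opprB.
        rewrite [w r - w s + _]addrA subrK; congr (_ + _).
        by rewrite -!scaleNr -scalerDl; congr (_ *: _); ring.
      apply: le_trans (ler_normB _ _) _.
      have h1 : `|r - s| < d1 by rewrite ger0_norm; lra.
      have h2 : `|l - s| < d1 by rewrite ler0_norm; lra.
      apply: le_trans (lerD (dP1 _ h1) (dP1 _ h2)) _.
      rewrite ger0_norm ?subr_ge0// ler0_norm ?subr_le0//; lra.
  have Os : O s.
    apply: NO; have [->|sa] := eqVneq s a; first by right; left.
    have [->|sb'] := eqVneq s b; first by right; right.
    left => h; apply: Ns; apply: h.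
    by rewrite !lt_neqAle as_ sb eq_sym sa sb'.
  have /nbhs_ballP[d1 /= d10 dP1] : nbhs s O by exact: open_nbhs_nbhs.
  exists d1 => // l r al /andP[ls sr] rb sl rs.
  exists 0, 0, [:: (l, r)]; split; rewrite ?big_seq1 ?add0r//=.
  - by exists c0; rewrite // scale0r.
  - split; first by split => //; lra.
    move=> x; rewrite inE => /eqP -> y /=; rewrite in_itv/= => /andP[ly yr].
    by apply: dP1; rewrite /ball/= ltr_distlC; apply/andP; split; lra.
  - by rewrite subr0 mulr0 add0r.
have [g [S [B [g0 [c Cc SE] [cB BO] BE wb]]]] := Pab.
have Beta : \sum_(x <- B) (x.2 - x.1) <= eta.
  rewrite -lee_fin; apply: le_trans muO.
  have mO : measurable (O : set (measurableTypeR R)) by exact: open_measurable.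
  apply: le_trans (chain_measure mO cB BO) _.
  apply: le_measure; rewrite ?inE//; apply: measurableI => //.
have Bd : \sum_(x <- B) (x.2 - x.1) < d.
  by apply: le_lt_trans Beta _; rewrite gt_min; apply/orP; left; lra.
have Ve := dP _ cB Bd; pose V := \sum_(x <- B) (x.2 - x.1).
have [ab0|abn] := eqVneq a b.
  exists c0 => //; subst b; rewrite !subrr scale0r subr0 normr0; lra.
have ab0 : 0 < b - a by rewrite subr_gt0 lt_neqAle abn.
have V0 : 0 <= V.
  rewrite /V big_seq; apply: sumr_ge0 => x xB.
  by have [_] := chain_bounds (0, 0) cB (etrans (index_mem x B) xB);
    rewrite nth_index// subr_ge0.
(* The weights sum to 1 only after the bad intervals are given the velocity [c0]. *)
exists ((g / (b - a)) *: c + (1 - g / (b - a)) *: c0).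
  apply: cC => //; rewrite divr_ge0 ?(ltW ab0)//= ler_pdivrMr// mul1r -BE.
  by rewrite lerDl.
have -> : (b - a) *: ((g / (b - a)) *: c + (1 - g / (b - a)) *: c0) =
    S + V *: c0.
  rewrite scalerDr !scalerA SE; congr (_ *: _ + _ *: _).
    by rewrite mulrC divfK// gt_eqF.
  by rewrite mulrBr mulr1 mulrC divfK ?gt_eqF//; rewrite -BE -/V; ring.
rewrite opprD addrA.
apply: le_trans (ler_normB _ _) _.
have h1 : `|V *: c0| <= e / 2.
  rewrite normrZ ger0_norm//.
  apply: (@le_trans _ _ (eta * (1 + `|c0|))).
    by apply: ler_pM => //; rewrite lerDr.
  by rewrite -ler_pdivlMr// ge_min lexx orbT.
have h2 : e * g <= (b - a) * e.
  by rewrite mulrC ler_wpM2r ?(ltW e0)// -BE lerDl.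
by apply: le_trans (lerD wb h1) _; lra.
Qed.

(** Closedness turns the approximations into an exact statement. For differential
    inclusions this lemma plays the role that integrating the velocity plays for
    differential equations. *)
Lemma mean_value w (a b : R) C : a <= b ->
  absolutely_continuous a b w -> cvx C -> closed C -> C !=set0 ->
  {ae mu, forall s, a < s < b -> exists2 v, has_deriv w s v & C v} ->
  exists2 c, C c & w b - w a = (b - a) *: c.
Proof.
move=> ab wac cC clC C0 aeN.
have [<-|abn] := eqVneq a b.
  by case: C0 => c0 ?; exists c0; rewrite // !subrr scale0r.
have ab0 : 0 < b - a by rewrite subr_gt0 lt_neqAle abn.
exists ((b - a)^-1 *: (w b - w a)); last first.
  by rewrite scalerA mulfV ?gt_eqF// scale1r.
apply: clC; apply/closure_normP => e e0.
pose e' := e * (b - a) / (2 * (b - a + 1)).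
have b1 : 0 < b - a + 1 by rewrite addr_gt0.
have e'0 : 0 < e' by rewrite /e' divr_gt0 ?mulr_gt0.
have [c Cc wc] := mean_value_approx ab e'0 wac cC C0 aeN.
exists c => //.
have -> : (b - a)^-1 *: (w b - w a) - c =
    (b - a)^-1 *: (w b - w a - (b - a) *: c).
  by rewrite [RHS]scalerBr scalerA mulVf ?gt_eqF// scale1r.
rewrite normrZ gtr0_norm ?invr_gt0// mulrC ltr_pdivrMr//.
apply: le_lt_trans wc _.
have -> : (b - a) * e' + e' = e * (b - a) / 2.
  by rewrite /e'; field; rewrite gt_eqF.
have := mulr_gt0 e0 ab0; lra.
Qed.

End MeanValue.

(** * Curves, Lipschitz bounds and growth estimates *)

Section Calculus.
Context {R : realType}.
Implicit Types E F : normedModType R.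
Notation mu := (@lebesgue_measure R).

Lemma norm_pairE E F (x : E) (y : F) : `|(x, y)| = Num.max `|x| `|y|.
Proof. by []. Qed.

Lemma norm_fst_le E F (x : E * F) : `|x.1| <= `|x|.
Proof. by case: x => x y; rewrite norm_pairE le_max lexx. Qed.

Lemma norm_snd_le E F (x : E * F) : `|x.2| <= `|x|.
Proof. by case: x => x y; rewrite norm_pairE le_max lexx orbT. Qed.

Lemma has_deriv_pair E F (w1 : R -> E) (w2 : R -> F) s v1 v2 :
  has_deriv w1 s v1 -> has_deriv w2 s v2 ->
  has_deriv (fun r => (w1 r, w2 r)) s (v1, v2).
Proof.
move=> h1 h2 e e0; have [d1 d10 P1] := h1 _ e0; have [d2 d20 P2] := h2 _ e0.
exists (Num.min d1 d2); first by rewrite lt_min d10.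
move=> h; rewrite lt_min => /andP[hd1 hd2].
by rewrite norm_pairE/= ge_max P1// P2.
Qed.

Lemma has_deriv_fst E F (w : R -> E * F) s v :
  has_deriv w s v -> has_deriv (fun r => (w r).1) s v.1.
Proof.
move=> hw e e0; have [d d0 P] := hw _ e0; exists d => // h /P.
exact: le_trans (norm_fst_le (w (s + h) - w s - h *: v)).
Qed.

Lemma has_deriv_snd E F (w : R -> E * F) s v :
  has_deriv w s v -> has_deriv (fun r => (w r).2) s v.2.
Proof.
move=> hw e e0; have [d d0 P] := hw _ e0; exists d => // h /P.
exact: le_trans (norm_snd_le (w (s + h) - w s - h *: v)).
Qed.

Lemma has_derivB E (w1 w2 : R -> E) s v1 v2 :
  has_deriv w1 s v1 -> has_deriv w2 s v2 ->
  has_deriv (fun r => w1 r - w2 r) s (v1 - v2).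
Proof. by move=> /has_derivP h1 /has_derivP h2; apply/has_derivP; exact: (is_deriveB h1 h2). Qed.

Lemma has_deriv_cst E (c : E) s : has_deriv (cst c) s 0.
Proof. by apply/has_derivP. Qed.

Lemma has_deriv_id (s : R) : has_deriv id s (1 : R).
Proof. by apply/has_derivP. Qed.

Lemma has_deriv_near E (w1 w2 : R -> E) s v (d : R) : 0 < d ->
  (forall r, `|r - s| < d -> w1 r = w2 r) -> has_deriv w1 s v -> has_deriv w2 s v.
Proof.
move=> d0 w12 h1 e e0; have [d1 d10 P1] := h1 _ e0.
exists (Num.min d d1); first by rewrite lt_min d0.
move=> h; rewrite lt_min => /andP[hd hd1].
rewrite -!w12; first exact: P1.
  by rewrite subrr normr0.
by rewrite [s + h]addrC addrK.
Qed.

Lemma has_deriv_itv E (w1 w2 : R -> E) (a b s : R) v : a < s < b ->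
  (forall r, a <= r <= b -> w1 r = w2 r) -> has_deriv w1 s v -> has_deriv w2 s v.
Proof.
move=> /andP[as_ sb] w12.
apply: (@has_deriv_near _ _ _ _ _ (Num.min (s - a) (b - s))).
  by rewrite lt_min !subr_gt0 as_.
move=> r; rewrite lt_min ltr_norml => /andP[/andP[h1 h2]].
rewrite ltr_norml => /andP[h3 h4].
by apply: w12; apply/andP; split; lra.
Qed.

Lemma has_deriv_shift E (w : R -> E) (t s : R) v :
  has_deriv w (t + s) v -> has_deriv (fun r => w (t + r)) s v.
Proof.
by move=> hw e e0; have [d d0 P] := hw _ e0; exists d => // h /P; rewrite addrA.
Qed.

Lemma norm_rV_le n (x : 'rV[R]_n) (c : R) : 0 <= c ->
  (forall j, `|x ord0 j| <= c) -> `|x| <= c.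
Proof.
move=> c0 xc; rewrite /Num.norm/= mx_normrE; apply/bigmax_leP; split => // -[i j] _.
by rewrite /= ord1.
Qed.

Lemma norm_rV_coord n (x : 'rV[R]_n) j : `|x ord0 j| <= `|x|.
Proof.
rewrite [leRHS]/Num.norm/= mx_normrE.
exact: (le_bigmax _ (fun ij => `|x ij.1 ij.2|) (ord0, j)).
Qed.

Lemma has_deriv_row n (w : R -> 'rV[R]_n) (s : R) (v : 'rV[R]_n) :
  (forall j, has_deriv (fun r => w r ord0 j : R) s (v ord0 j : R)) ->
  has_deriv w s v.
Proof.
move=> hw e e0.
have /choice[d dP] : forall j, exists d : R, 0 < d /\ forall h : R, `|h| < d ->
    `|w (s + h) ord0 j - w s ord0 j - h * v ord0 j| <= e * `|h|.
  by move=> j; have [d d0 P] := hw j _ e0; exists d.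
exists (\big[Num.min/1]_j d j).
  by apply/bigmin_gtP; split => [|j _]; [exact: ltr01|have [] := dP j].
move=> h /bigmin_gtP[_ hd].
apply: norm_rV_le; first by rewrite mulr_ge0// ltW.
by move=> j; rewrite !mxE; have [_] := dP j; apply; exact: hd.
Qed.

Definition lip_on E (a b M : R) (w : R -> E) := forall r s : R,
  a <= r <= b -> a <= s <= b -> `|w r - w s| <= M * `|r - s|.

Lemma lip_ac E a b M (w : R -> E) : lip_on a b M w -> absolutely_continuous a b w.
Proof.
move=> wM e e0.
have M1 : 0 < `|M| + 1 by rewrite ltr_pwDr.
exists (e / (`|M| + 1)); first exact: divr_gt0.
move=> k l r lr _; rewrite ltr_pdivlMr// => h.
apply: le_lt_trans h; rewrite mulr_suml; apply: ler_sum => i _.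
have [h1 [h2 h3]] := lr i.
apply: le_trans (wM _ _ _ _) _; [apply/andP; split; lra..|].
rewrite ger0_norm ?subr_ge0// mulrC ler_wpM2l ?subr_ge0//.
by rewrite (le_trans (ler_norm _))// lerDl.
Qed.

Lemma ac_sub E (a b a' b' : R) (w : R -> E) : a <= a' -> b' <= b ->
  absolutely_continuous a b w -> absolutely_continuous a' b' w.
Proof.
move=> aa bb wac e e0; have [d d0 P] := wac _ e0; exists d => // k l r lr.
by apply: P => i; have [h1 [h2 h3]] := lr i; split; [|split]; lra.
Qed.

Lemma ae_sub (P Q : R -> Prop) : (forall s, P s -> Q s) ->
  {ae mu, forall s, P s} -> {ae mu, forall s, Q s}.
Proof. by move=> PQ; exact: (@filterS _ _ (ae_filter_ringOfSetsType mu)). Qed.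

Lemma ae_and (P Q : R -> Prop) :
  {ae mu, forall s, P s} -> {ae mu, forall s, Q s} ->
  {ae mu, forall s, P s /\ Q s}.
Proof. exact: (@filterI _ _ (ae_filter_ringOfSetsType mu)). Qed.

Lemma ae_neq (c : R) : {ae mu, forall s, s <> c}.
Proof.
exists [set c]; split; [exact: measurable_set1|exact: lebesgue_measure_set1|].
by move=> s /= /contrapT.
Qed.

Lemma ac_image E F (a b : R) (w : R -> E) (w' : R -> F) :
  (forall r s, `|w' r - w' s| <= `|w r - w s|) ->
  absolutely_continuous a b w -> absolutely_continuous a b w'.
Proof.
move=> ww wac e e0; have [d d0 P] := wac e e0; exists d => // k l r lr tr lrd.
by apply: le_lt_trans (P k l r lr tr lrd); apply: ler_sum.
Qed.

(** The mean value theorem for a closed ball: a curve whose velocity stays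
    within [rho] of [c] drifts from uniform motion at rate at most [rho]. *)
Lemma mean_value_ball E a b (w : R -> E) c (rho : R) : a <= b -> 0 <= rho ->
  absolutely_continuous a b w ->
  {ae mu, forall s, a < s < b -> exists2 v, has_deriv w s v & `|v - c| <= rho} ->
  `|w b - w a - (b - a) *: c| <= rho * (b - a).
Proof.
move=> ab rho0 wac aew.
have [x|||v vc ->] := @mean_value _ _ w a b [set v | `|v - c| <= rho] ab wac _ _ _ aew.
- move=> y k /= xc yc /andP[k0 k1].
  have -> : k *: x + (1 - k) *: y - c = k *: (x - c) + (1 - k) *: (y - c).
    rewrite !scalerBr addrACA; congr (_ + _).
    by rewrite -opprD -scalerDl addrC subrK scale1r.
  apply: le_trans (ler_normD _ _) _; rewrite !normrZ !ger0_norm ?subr_ge0//.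
  have : k * `|x - c| <= k * rho by rewrite ler_wpM2l.
  have : (1 - k) * `|y - c| <= (1 - k) * rho by rewrite ler_wpM2l ?subr_ge0.
  lra.
- move=> x /closure_normP cx; rewrite /=; apply/ler_addgt0Pr => e e0.
  have [y /= yc xy] := cx _ e0.
  rewrite -(subrK y x) -addrA addrC.
  by apply: le_trans (ler_normD _ _) _; rewrite lerD// ltW.
- by exists c; rewrite /= subrr normr0.
by rewrite -scalerBr normrZ ger0_norm ?subr_ge0// mulrC ler_wpM2r ?subr_ge0.
Qed.

Lemma deriv_lip E a b (w : R -> E) (M : R) : 0 <= M ->
  absolutely_continuous a b w ->
  {ae mu, forall s, a < s < b -> exists2 v, has_deriv w s v & `|v| <= M} ->
  lip_on a b M w.
Proof.
move=> M0 wac aew.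
have main r s : a <= r -> r <= s -> s <= b -> `|w s - w r| <= M * (s - r).
  move=> ar rs sb.
  rewrite -[X in `|X|]subr0 -(scaler0 _ (s - r)).
  apply: mean_value_ball => //; first exact: ac_sub wac.
  apply: ae_sub aew => q H /andP[rq qs].
  by have [|v hv vM] := H _; [lra|exists v; rewrite // subr0].
move=> r s /andP[ar rb] /andP[as_ sb].
have [rs|/ltW sr] := leP r s.
  by rewrite distrC [`|r - s|]distrC [`|s - r|]ger0_norm ?subr_ge0//; exact: main.
by rewrite [`|r - s|]ger0_norm ?subr_ge0//; exact: main.
Qed.

Lemma lip_pair E F a b (w1 : R -> E) (w2 : R -> F) (M : R) :
  lip_on a b M w1 -> lip_on a b M w2 -> lip_on a b M (fun r => (w1 r, w2 r)).
Proof. by move=> h1 h2 r s hr hs; rewrite norm_pairE/= ge_max h1// h2. Qed.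

Lemma lip_le E a b (w : R -> E) (M M' : R) : M <= M' ->
  lip_on a b M w -> lip_on a b M' w.
Proof.
by move=> MM h r s hr hs; apply: le_trans (h _ _ hr hs) _; rewrite ler_wpM2r.
Qed.

Lemma lip_cst E (c : E) (a b M : R) : 0 <= M -> lip_on a b M (fun=> c).
Proof. by move=> M0 r s _ _; rewrite subrr normr0 mulr_ge0. Qed.

Lemma lipD_cst E (a b M0 : R) (x : E) (w : R -> E) :
  lip_on a b M0 w -> lip_on a b M0 (fun s => x + w s).
Proof.
move=> wl r s hr hs; apply: le_trans (wl r s hr hs).
by rewrite opprD addrACA subrr add0r.
Qed.

Lemma has_derivD_cst E (x : E) (w : R -> E) s v :
  has_deriv w s v -> has_deriv (fun r => x + w r) s v.
Proof.
move=> hw e e0; have [d d0 P] := hw e e0; exists d => // h /P.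
by rewrite opprD addrACA subrr add0r.
Qed.

Lemma lipB E a b M1 M2 (w1 w2 : R -> E) :
  lip_on a b M1 w1 -> lip_on a b M2 w2 -> lip_on a b (M1 + M2) (fun s => w1 s - w2 s).
Proof.
move=> l1 l2 r s hr hs.
have -> : w1 r - w2 r - (w1 s - w2 s) = (w1 r - w1 s) - (w2 r - w2 s).
  by rewrite !opprD !opprK addrACA.
rewrite mulrDl; apply: le_trans (ler_normB _ _) _.
by rewrite lerD ?l1 ?l2.
Qed.

Lemma has_deriv_expR (A k a s : R) :
  has_deriv (fun r : R => A * expR (k * (r - a))) s (A * k * expR (k * (s - a))).
Proof.
apply/has_derivP.
have -> : (fun r : R => A * expR (k * (r - a))) =
    (A \*: (expR \o (k \*: (id - cst a)))) by [].
apply: is_derive_eq.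
by rewrite /= subr0 /GRing.scale/=; ring.
Qed.

Lemma lip_expR (A k a b : R) : 0 <= A -> 0 <= k ->
  lip_on a b (A * k * expR (k * (b - a))) (fun r => A * expR (k * (r - a))).
Proof.
move=> A0 k0.
have main r s : a <= r -> r <= s -> s <= b ->
   A * expR (k * (s - a)) - A * expR (k * (r - a)) <=
   A * k * expR (k * (b - a)) * (s - r).
  move=> ar rs sb; rewrite -mulrBr -!mulrA ler_wpM2l//.
  have -> : k * (r - a) = k * (s - a) + k * (r - s) by ring.
  rewrite expRD -[X in X - _]mulr1 -mulrBr.
  apply: (@le_trans _ _ (expR (k * (s - a)) * (k * (s - r)))).
    rewrite ler_wpM2l ?expR_ge0//.
    have := expR_ge1Dx (k * (r - s)); lra.
  rewrite [leLHS]mulrCA ler_wpM2l// ler_wpM2r ?subr_ge0// ler_expR ler_wpM2l//.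
  lra.
have mon r s : r <= s -> A * expR (k * (r - a)) <= A * expR (k * (s - a)).
  by move=> rs; rewrite ler_wpM2l// ler_expR ler_wpM2l//; lra.
move=> r s /andP[ar rb] /andP[as_ sb].
have [rs|/ltW sr] := leP r s.
  by rewrite distrC [`|r - s|]distrC !ger0_norm ?subr_ge0 ?mon//; exact: main.
by rewrite !ger0_norm ?subr_ge0 ?mon//; exact: main.
Qed.

(** The pair of the curve and the exponential has its derivative in the closed
    convex cone of those [(v, r)] with [`|v| <= r], hence its increment lies in the
    same cone. This is the comparison principle behind the Picard iteration. *)
Lemma exp_growth E a b (w : R -> E) (A k : R) : a <= b -> 0 <= A -> 0 <= k ->
  (exists M, lip_on a b M w) ->
  {ae mu, forall s, a < s < b ->
    exists2 v, has_deriv w s v & `|v| <= A * k * expR (k * (s - a))} ->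
  `|w b - w a| <= A * expR (k * (b - a)).
Proof.
move=> ab A0 k0 [M wM] aew.
pose ph r := A * expR (k * (r - a)).
pose C := [set x : E * R | `|x.1| <= x.2].
have lw : absolutely_continuous a b (fun r => (w r, ph r)).
  apply: (@lip_ac _ _ _ (Num.max M (A * k * expR (k * (b - a))))).
  apply: lip_pair.
    by apply: lip_le wM; rewrite le_max lexx.
  by have := @lip_expR A k a b A0 k0; apply: lip_le; rewrite le_max lexx orbT.
have [x y l /= Cx Cy /andP[l0 l1]||||[c1 c2] /= Cc [wE phE]] :=
    @mean_value _ _ (fun r => (w r, ph r)) a b C ab lw.
- rewrite /C/=; apply: le_trans (ler_normD _ _) _; rewrite !normrZ !ger0_norm ?subr_ge0//.
  by rewrite lerD// ler_wpM2l ?subr_ge0.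
- move=> [x y] /closure_normP cx; rewrite /C/=; apply/ler_addgt0Pr => e e0.
  have [[x' y'] /= Cy] := cx (e / 2) (divr_gt0 e0 (ltr0n _ 2)).
  rewrite norm_pairE/= gt_max => /andP[h1 h2].
  rewrite -(subrK x' x); apply: le_trans (ler_normD _ _) _.
  move: Cy h2; rewrite /C/= ltr_norml => Cy /andP[h2 h3]; lra.
- by exists (0, 0); rewrite /C/= normr0.
- apply: ae_sub aew => s H /H[v hv vk].
  exists (v, A * k * expR (k * (s - a))) => //.
  by apply: has_deriv_pair => //; exact: has_deriv_expR.
rewrite wE normrZ ger0_norm ?subr_ge0//.
apply: (@le_trans _ _ ((b - a) * c2)); first by rewrite ler_wpM2l ?subr_ge0.
have -> : (b - a) * c2 = ph b - ph a by rewrite phE.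
by rewrite gerBl /ph mulr_ge0// expR_ge0.
Qed.

End Calculus.

(** * Differentiating the integral of a Lebesgue measurable function *)

Section LebesgueFTC.
Context {R : realType}.
Notation mu := (@lebesgue_measure R).
Notation cmu := (@completed_lebesgue_measure R).

Lemma lebesgue_measurable_itv (i : interval R) :
  measurable ([set` i] : set (lebesgueR R)).
Proof. by apply: sub_caratheodory; exact: measurable_itv. Qed.

(** Each of the countably many superlevel sets of [g] at rational heights is a
    Borel set up to a null set. On the complement of a Borel null set that contains
    all the exceptional parts, [g] has Borel superlevel sets. *)
Lemma borel_modification (g : lebesgueR R -> R) :
  measurable_fun setT g ->
  exists N : set (measurableTypeR R), [/\ measurable N, mu N = 0 &
    measurable_fun setT
      ((fun s => if s \in N then 0 else g s) : measurableTypeR R -> R)].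
Proof.
move=> mg.
have /choice[BN BNP] : forall q : rat, exists BN : set R * set R,
   [/\ measurable (BN.1 : set (measurableTypeR R)), mu.-negligible BN.2 &
     [set s | ratr q < g s] = BN.1 `|` BN.2].
  move=> q.
  have : measurable ([set s | ratr q < g s] : set (lebesgueR R)).
    have := mg measurableT `](ratr q), +oo[%classic (measurable_itv _).
    rewrite setTI; congr (measurable _); apply/funext => s.
    by rewrite /= in_itv/= andbT.
  rewrite /measurable/=.
  have := @completed_caratheodory_measurable R.
  rewrite g_sigma_completed_algebra_genE /measurable/= => <-.
  by move=> [B mB [N nN BN]]; exists (B, N).
pose F n := if @unpickle rat n is Some q then (BN q).2 else set0.
have [N [mN N0 FN]] : mu.-negligible (\bigcup_n F n).
  apply: negligible_bigcup => n; rewrite /F.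
  case: unpickle => [q|]; last exact: negligible_set0.
  by have [] := BNP q.
have subN q : (BN q).2 `<=` N.
  have [k Fk] : exists k, F k = (BN q).2 by exists (pickle q); rewrite /F pickleK.
  by move=> s qs; apply: FN; exists k => //; rewrite Fk.
exists N; split => //.
move=> mT; apply: (measurability _ (RGenOInfty.measurableE R)) => //.
move=> /= _ [_ [x ->] <-]; rewrite setTI.
have mx : measurable (if x < 0 then N else set0).
  by case: ifP => _.
(* Outside [N] a superlevel set is a union of rational ones; on [N] the modified
   function vanishes. *)
rewrite [X in measurable X](_ : _ = (\bigcup_(q : rat)
    if x < ratr q then (BN q).1 `\` N else set0) `|` (if x < 0 then N else set0)).
  apply: measurableU => //; apply: bigcupT_measurable_rat => q.
  by case: ifP => // _; apply: measurableD => //; have [] := BNP q.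
apply/seteqP; split=> [s|s] /=; rewrite in_itv/= andbT.
  case: ifPn => sN xs.
    by right; rewrite xs; move: sN; rewrite inE.
  left; have [q /andP[xq qs]] : exists q, x < ratr q < g s.
    by have [q] := rat_in_itvoo xs; rewrite in_itv/=; exists q.
  exists q => //; rewrite xq; split; last by move=> /mem_set; exact/negP.
  have [_ _ /seteqP[/(_ s qs) [//|sN2] _]] := BNP q.
  by exfalso; move/negP: sN; apply; exact/mem_set/(subN q).
case=> [[q _]|].
  case: ifPn => // xq [qs sN]; rewrite ifN; last by apply/negP => /set_mem.
  apply: lt_trans xq _.
  by have [_ _ /seteqP[_ /(_ s)]] := BNP q; apply; left.
by case: ifPn => // x0 sN; rewrite mem_set.
Qed.

(** The Lebesgue measure is the image of its completion under the identity. *)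
Lemma completed_Rintegral (D : set R) (g : R -> R) :
  measurable (D : set (measurableTypeR R)) ->
  measurable_fun setT (g : measurableTypeR R -> R) ->
  \int[cmu]_(s in D) g s = \int[mu]_(s in D) g s.
Proof.
move=> mD mg; rewrite /Rintegral; congr fine.
have mid : measurable_fun setT (idfun : lebesgueR R -> measurableTypeR R).
  by move=> _ A mA; rewrite setTI; exact: sub_caratheodory.
pose phi : {mfun lebesgueR R >-> measurableTypeR R} :=
  HB.pack (idfun : lebesgueR R -> measurableTypeR R)
    (isMeasurableFun.Build _ _ _ _ _ mid).
have mgE : measurable_fun setT (EFin \o g : measurableTypeR R -> \bar R).
  exact/measurable_EFinP.
have E (h : measurableTypeR R -> \bar R) : measurable_fun setT h ->
    (forall y, 0 <= h y)%E -> (\int[cmu]_(x in D) h x = \int[mu]_(x in D) h x)%E.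
  move=> mh h0.
  rewrite [RHS](@eq_measure_integral _ _ _ _ (pushforward cmu phi)) //.
  rewrite ge0_integral_pushforward//; first exact: measurable_funTS.
rewrite integralE [RHS]integralE; congr (_ - _)%E; apply: E => //.
  exact: measurable_funepos.
exact: measurable_funeneg.
Qed.

Lemma bounded_integrable (g : R -> R) (M : R) (D : set R) :
  measurable_fun setT (g : measurableTypeR R -> R) -> (forall s, `|g s| <= M) ->
  measurable (D : set (measurableTypeR R)) -> (mu D < +oo)%E ->
  mu.-integrable D (EFin \o g).
Proof.
move=> mg gM mD Doo; apply: measurable_bounded_integrable => //.
  exact: measurable_funTS.
exists M; split; first exact: num_real.
by move=> x Mx s _; apply: le_trans (gM s) _; exact: ltW.
Qed.

(** A Borel modification of [g] has the same integrals, and Lebesgue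
    differentiation applies to it. *)
Lemma lebesgue_FTC (g : R -> R) (a b M : R) : a <= b ->
  measurable_fun (`[a, b]%classic : set (lebesgueR R)) (g : lebesgueR R -> R) ->
  (forall s, a <= s <= b -> `|g s| <= M) ->
  let G s := \int[cmu]_(r in `[a, s]) g r in
  [/\ G a = 0, lip_on a b M G &
    {ae mu, forall s, a < s < b -> has_deriv G s (g s : R)}].
Proof.
move=> ab mg gM G.
have M0 : 0 <= M by apply: le_trans (normr_ge0 _) (gM a _); rewrite lexx.
have mab := lebesgue_measurable_itv `[a, b].
pose g0 : lebesgueR R -> R := g \_ `[a, b]%classic.
have mg0 : measurable_fun setT g0 by apply/(measurable_restrictT _ _).1.
have g0M s : `|g0 s| <= M.
  rewrite /g0 patchE; case: ifPn => [|_]; last by rewrite normr0.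
  by rewrite inE/= in_itv/= => /gM.
have [N [mN N0]] := borel_modification mg0.
set g1 := (fun s => _) => mg1.
have g1M s : `|g1 s| <= M by rewrite /g1; case: ifP => // _; rewrite normr0.
have ig1 (i : interval R) : (mu [set` i] < +oo)%E ->
    mu.-integrable [set` i] (EFin \o g1).
  by move=> ioo; apply: (bounded_integrable mg1 g1M).
have oo1 (c1 c2 : bool) (x y : R) : (mu [set` Interval (BSide c1 x) (BSide c2 y)] < +oo)%E.
  by rewrite lebesgue_measure_itv/=; case: ifP => // _; rewrite -EFinB ltry.
pose F s := \int[mu]_(r in `[a, s]) g1 r.
have GF s : a <= s <= b -> G s = F s.
  move=> /andP[as_ sb].
  have mas := lebesgue_measurable_itv `[a, s].
  rewrite /F -completed_Rintegral//.
  rewrite /G /Rintegral; congr fine.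
  transitivity (\int[cmu]_(r in `[a, s]) (EFin \o g0) r)%E.
    apply: eq_integral => r; rewrite inE/= in_itv/= => /andP[ar rs].
    by rewrite /g0 patchE mem_set//= in_itv/= ar (le_trans rs).
  have mE0 : measurable_fun setT (EFin \o g0) by apply/measurable_EFinP.
  have mE1 : measurable_fun setT (EFin \o (g1 : lebesgueR R -> R)).
    apply/measurable_EFinP => _ A mA; rewrite setTI.
    apply: sub_caratheodory; rewrite -[X in _ X]setTI; exact: mg1.
  apply: ae_eq_integral; [exact: mas|exact: measurable_funTS|exact: measurable_funTS|].
  exists N; split => //; first exact: sub_caratheodory.
  move=> r /= h; apply: contrapT => Nr; apply: h => _.
  by rewrite /g1 /= ifN//; apply/negP => /set_mem.
split.
- by rewrite GF ?lexx ?ab// /F set_itv1 Rintegral_set1.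
- have main r s : a <= r -> r <= s -> s <= b -> `|G s - G r| <= M * (s - r).
    move=> ar rs sb; rewrite !GF ?ar ?rs ?sb ?(le_trans ar)//; last exact: le_trans sb.
    rewrite /F Rintegral_itvB; [|exact: ig1|by rewrite bnd_simp|by rewrite bnd_simp].
    apply: le_trans (le_normr_Rintegral _ _) _ => //; first exact: ig1.
    apply: (@le_trans _ _ (\int[mu]_(x in `]r, s]) M)).
      apply: le_Rintegral => //; [exact: integrable_norm (ig1 _ _)|].
      by apply: (@bounded_integrable _ M) => // _; rewrite ger0_norm.
    rewrite Rintegral_cst//= lebesgue_measure_itv/= lte_fin.
    by rewrite ler_wpM2l//; case: ltP => /=; lra.
  move=> r s /andP[ar rb] /andP[as_ sb].
  have [rs|/ltW sr] := leP r s.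
    by rewrite distrC [`|r - s|]distrC [`|s - r|]ger0_norm ?subr_ge0//; exact: main.
  by rewrite [`|r - s|]ger0_norm ?subr_ge0//; exact: main.
have lg1 : locally_integrable setT g1.
  split => //; first exact: openT.
  move=> K _ cK.
  have mK : measurable (K : set (measurableTypeR R)) by exact: compact_measurable.
  have /integrableP[_] : mu.-integrable K (EFin \o g1).
    by apply: bounded_integrable g1M _ _ => //; exact: compact_finite_measure.
  exact.
have nN : {ae mu, forall s, ~ N s}.
  by exists N; split => // s /= /contrapT.
have iay y : mu.-integrable [set` Interval (BLeft a) (BRight y)] (EFin \o g1).
  exact: ig1.
have := ae_and nN (FTC1 iay lg1); apply: ae_sub => s [Ns dF] /andP[as_ sb].
have [|dFs] := dF; first by rewrite /= lte_fin.
rewrite derive1E => Fs.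
apply: (@has_deriv_itv _ _ F G a b); rewrite ?as_//.
  by move=> r /GF.
have -> : g s = g1 s.
  rewrite /g1 ifN; last by apply/negP => /set_mem.
  by rewrite /g0 patchE mem_set//= in_itv/= !ltW.
exact/has_derivP/(DeriveDef dFs).
Qed.

End LebesgueFTC.

(** * Lipschitz functions are differentiable almost everywhere *)

Section LipschitzDifferentiable.
Context {R : realType}.
Notation mu := (@lebesgue_measure R).

(** A cover of a null set by intervals of small total length has a small total
    increment of [F]. *)
Lemma stieltjes_dominated (F : cumulative R R) (M : R) : 0 <= M ->
  (forall r s, r <= s -> F s - F r <= M * (s - r)) ->
  lebesgue_stieltjes_measure F `<< mu.
Proof.
move=> M0 FM; apply/null_content_dominatesP => A mA muA.
apply/eqP; rewrite eq_le measure_ge0 andbT; apply/lee_addgt0Pr => e e0.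
rewrite add0e.
have M1 : 0 < M + 1 by rewrite ltr_pwDr.
have eM : 0 < e / (M + 1) by rewrite divr_gt0.
have : mu A \is a fin_num by rewrite muA.
move=> /lb_ereal_inf_adherent-/(_ _ eM)[_/= [B AB] <-].
rewrite [X in (X + _)%E]muA add0e => Be.
apply: (@le_trans _ _ (\sum_(0 <= k <oo) wlength F (B k)))%E.
  by apply: ereal_inf_lbound; exists B.
apply: (@le_trans _ _ (\sum_(0 <= k <oo) (M + 1)%:E * wlength idfun (B k)))%E.
  apply: lee_nneseries => [i _ _|i _]; first exact: wlength_ge0.
  have [[x xT <-] _] := (AB.1 i, tt).
  rewrite !wlength_itv/=; case: ifPn => [xx|_]; last by rewrite mule0.
  rewrite -!EFinB -EFinM lee_fin.
  apply: le_trans (FM _ _ _) _; first by rewrite ltW.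
  by rewrite ler_wpM2r ?lerDl// subr_ge0 ltW.
rewrite nneseriesZl; last by move=> i _; exact: wlength_ge0.
rewrite (_ : e = (M + 1) * (e / (M + 1))); last by rewrite mulrC divfK ?gt_eqF.
rewrite EFinM.
by rewrite lee_wpmul2l ?lee_fin ?ltW.
Qed.

(** Adding a multiple of the identity makes [w] nondecreasing. The associated
    Stieltjes measure is dominated by the Lebesgue measure, and Lebesgue
    differentiation applied to its Radon-Nikodym density gives the derivative. *)
Lemma lipschitz_ae_derivable (w : R -> R) (M a b : R) :
  (forall r s, `|w r - w s| <= M * `|r - s|) ->
  {ae mu, forall s, a < s < b -> exists v : R, has_deriv w s v}.
Proof.
move=> wM.
have [ba|ab] := leP b a.
  apply: (@ae_sub _ (fun=> True)); last exact: aeW.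
  by move=> s _ /andP[as_ sb]; move: (lt_trans as_ sb); rewrite ltNge ba.
have M0 : 0 <= `|M| by [].
have wM' r s : `|w r - w s| <= `|M| * `|r - s|.
  by apply: le_trans (wM r s) _; rewrite ler_wpM2r// ler_norm.
pose F0 := fun r : R => w r + `|M| * r : R.
have F0nd : {homo F0 : r s / r <= s}.
  move=> r s rs; rewrite /F0; have := wM' r s; rewrite [`|r - s|]ler0_norm ?subr_le0// opprB ler_norml => /andP[_].
  lra.
have F0M r s : r <= s -> F0 s - F0 r <= 2 * `|M| * (s - r).
  move=> rs; have := wM' r s; rewrite [`|r - s|]ler0_norm ?subr_le0// opprB ler_norml.
  by move=> /andP[h _]; rewrite /F0; lra.
have F0c : continuous F0.
  move=> x; apply: (@continuousD _ _ _ w (fun r => `|M| * r)).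
    apply/cvgrPdist_le => e e0.
    have M1 : 0 < `|M| + 1 by rewrite ltr_pwDr.
    exists (e / (`|M| + 1)); first exact: divr_gt0.
    move=> y; rewrite /ball_/= ltr_pdivlMr// => xy.
    apply: le_trans (wM' _ _) _; apply: le_trans (ltW xy).
    by rewrite mulrC ler_wpM2l// lerDl.
  by apply: continuousM; [exact: cvg_cst|exact: cvg_id].
pose F : cumulative R R :=
  HB.pack F0 (isCumulative.Build R _ R F0 F0nd (right_continuousW F0c)).
pose nu : {measure set (measurableTypeR R) -> \bar R} :=
  lebesgue_stieltjes_measure F.
have numu : nu `<< mu by apply: (@stieltjes_dominated F (2 * `|M|)) => //; rewrite mulr_ge0.
have nuE x y : x <= y -> nu `]x, y]%classic = (F0 y - F0 x)%:E.
  move=> xy; transitivity (wlength F `]x, y]%classic).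
    exact: (measurable_mu_extE (wlength F) (is_ocitv x y)).
  rewrite wlength_itv/= lte_fin; move: xy; rewrite le_eqVlt => /predU1P[->|->].
    by rewrite ltxx subrr.
  by rewrite -EFinB.
have mD : measurable (`]a, b]%classic : set (measurableTypeR R)) by exact: measurable_itv.
have nuD : (nu `]a, b]%classic < +oo)%E by rewrite nuE ?ltW// ltry.
(* Restricting to the bounded interval makes the measure finite. *)
pose nu1 : {finite_measure set (measurableTypeR R) -> \bar R} := mfrestr mD nuD.
have nu1mu : nu1 `<< mu.
  apply/null_content_dominatesP => A mA muA.
  move/null_content_dominatesP : numu => /(_ A mA muA) nuA.
  apply/eqP; rewrite eq_le measure_ge0 andbT -nuA /nu1 /= /mfrestr /mrestr.
  by apply: le_measure; rewrite ?inE//; exact: measurableI.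
have [h [h0 hfin hint hE]] := radon_nikodym_sigma_finite nu1mu.
pose f : R -> R := fine \o h.
have fh : EFin \o f = h by apply/funext => x; rewrite /= fineK.
have fint (A : set (measurableTypeR R)) : measurable A ->
    mu.-integrable A (EFin \o f).
  by move=> mA; rewrite fh; apply: integrableS hint.
have floc : locally_integrable [set: R] f.
  by apply: open_integrable_locally; [exact: openT|exact: fint].
have fE y : a <= y <= b -> \int[mu]_(r in `]a, y]) f r = F0 y - F0 a.
  move=> /andP[ay yb]; rewrite /Rintegral (_ : (fun r => (f r)%:E) = h) -?hE// ?fh//.
  rewrite /nu1 /= /mfrestr /mrestr setIidl ?nuE//.
  by move=> r /=; rewrite !in_itv/= => /andP[-> /le_trans ->].
have fay y : mu.-integrable [set` Interval (BRight a) (BRight y)] (EFin \o f).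
  by apply: fint; exact: measurable_itv.
have := FTC1 fay floc; apply: ae_sub => s dF /andP[as_ sb].
have [|dFs] := dF; first by rewrite /= lte_fin.
rewrite derive1E => Fs; exists (f s - `|M|).
pose G r := \int[mu]_(t in `]a, r]) f t - (`|M| * r - F0 a).
apply: (@has_deriv_itv _ _ G w a b); rewrite ?as_//.
  by move=> r /fE rE; rewrite /G rE /F0; ring.
apply: has_derivB; first exact/has_derivP/(DeriveDef dFs).
apply/has_derivP.
apply: is_derive_eq.
by rewrite subr0 /GRing.scale/= mulr1.
Qed.

End LipschitzDifferentiable.

(** * Measurability of a field along a trajectory *)

Section Measurability.
Context {R : realType} (n m : nat).
Variables (U : set 'rV[R]_m) (g : 'rV[R]_n -> 'rV[R]_m -> R).
Hypothesis g_cont : {within [set: 'rV[R]_n] `*` U,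
  continuous (fun xu : 'rV[R]_n * 'rV[R]_m => g xu.1 xu.2)}.
Variables (u : R -> 'rV[R]_m) (a b : R).
Hypothesis uU : forall s, a <= s <= b -> U (u s).
Hypothesis u_meas : lebesgue_measurable_fun `[a, b]%classic u.

(** Since [g c] is continuous on [U] only, the preimage of an open set is the
    trace on [U] of an open set, which is enough because [u] stays in [U]. *)
Lemma measurable_frozen_state (c : 'rV[R]_n) :
  measurable_fun (`[a, b]%classic : set (lebesgueR R))
    ((fun s => g c (u s)) : lebesgueR R -> R).
Proof.
move=> mD; apply: (measurability _ (RGenOpens.measurableE R)) => //.
move=> /= _ [_ [x [y ->]] <-].
have oxy : open `]x, y[%classic by exact: interval_open.
have /continuousP/(_ _ oxy)/open_subspaceP[V oV VE] := g_cont.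
have oO : open [set v | V (c, v)].
  have -> : [set v | V (c, v)] = (pair c) @^-1` V by [].
  apply: open_comp oV => v _.
  move=> B /nbhs_ballP[e e0 eB]; apply/nbhs_ballP; exists e => // w vw.
  by apply: eB; split => //=; exact: ballxx.
have mO : measurable ([set v | V (c, v)] : set (borel_rV R m)).
  by apply: sub_sigma_algebra.
have u_meas' : measurable_fun (`[a, b]%classic : set (lebesgueR R))
  (u : lebesgueR R -> borel_rV R m) := u_meas.
have := u_meas' mD _ mO.
congr (measurable _); apply/seteqP.
have UV s : `[a, b]%classic s -> V (c, u s) <-> x < g c (u s) < y.
  rewrite /= in_itv/= => /uU Us; have /seteqP[h1 h2] := VE.
  split=> h.
    by have [/=] := h1 (c, u s) (conj h (conj I Us)); rewrite in_itv.
  by have [|//] := h2 (c, u s); split => //=.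
by split=> s [sD /=]; rewrite in_itv/= => /(UV _ sD) h; split.
Qed.

Variables (K M : R) (y : R -> 'rV[R]_n).
Hypothesis K_ge0 : 0 <= K.
Hypothesis g_lip : forall x1 x2 v, U v -> `|g x1 v - g x2 v| <= K * `|x1 - x2|.
Hypothesis y_lip : lip_on a b M y.

(** Replacing [y] by its values on finer and finer grids leaves countably many
    frozen states at each stage; the Lipschitz bound in the state makes these
    approximations converge. *)
Lemma measurable_along :
  measurable_fun (`[a, b]%classic : set (lebesgueR R))
    ((fun s => g (y s) (u s)) : lebesgueR R -> R).
Proof.
have M0 : 0 <= `|M| by [].
have y_lip' : lip_on a b `|M| y by apply: lip_le y_lip; exact: ler_norm.
(* The last point of the grid of mesh [1 / k.+1] before [s]. *)
pose q (k : nat) (s : R) : R := a + (Num.truncn ((s - a) * k.+1%:R))%:R / k.+1%:R.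
have qP k s : a <= s <= b -> [/\ a <= q k s, q k s <= s & s - q k s <= k.+1%:R^-1].
  move=> /andP[as_ sb].
  have /truncn_itv/andP[h1 h2] : 0 <= (s - a) * k.+1%:R.
    by rewrite mulr_ge0// subr_ge0.
  split; rewrite /q.
  - by rewrite lerDl divr_ge0.
  - by rewrite -lerBrDl ler_pdivrMr.
  - rewrite opprD addrA lerBlDr -[X in _ <= X + _]mul1r -mulrDl ler_pdivlMr//.
    by move: h2; rewrite [X in _ < X]mulrS => /ltW.
apply: (@measurable_fun_cvg _ (lebesgueR R) R `[a, b]%classic
  (fun k s => g (y (q k s)) (u s))).
  move=> k mD A mA.
  pose I (i : nat) : set R := `[a + i%:R / k.+1%:R, a + i.+1%:R / k.+1%:R[%classic.
  rewrite [X in measurable X](_ : _ = \bigcup_i (I i `&` (`[a, b]%classic `&`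
      (fun s => g (y (a + i%:R / k.+1%:R)) (u s)) @^-1` A))).
    apply: bigcupT_measurable => i; apply: measurableI.
      exact: lebesgue_measurable_itv.
    exact: measurable_frozen_state.
  have IP i s : a <= s -> I i s -> Num.truncn ((s - a) * k.+1%:R) = i.
    move=> as_; rewrite /I/= in_itv/= => /andP[h1 h2]; apply: truncn_def.
    by rewrite -ler_pdivrMr// -ltr_pdivlMr// lerBrDl ltrBlDl h1.
  apply/seteqP; split=> [s [sD As]|s [i _ [Is [sD As]]]].
    have /andP[as_ sb] : a <= s <= b by move: sD; rewrite /= in_itv.
    exists (Num.truncn ((s - a) * k.+1%:R)) => //; split => //.
    rewrite /I/= in_itv/= -lerBrDl -ltrBlDl ler_pdivrMr// ltr_pdivlMr//.
    by apply: truncn_itv; rewrite mulr_ge0// subr_ge0.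
  have /andP[as_ sb] : a <= s <= b by move: sD; rewrite /= in_itv.
  by split => //; rewrite /= /q (IP i).
move=> s; rewrite /= in_itv/= => sD.
have Us := uU sD.
apply/cvgrPdist_le => e e0.
have c0 : 0 < K * `|M| + 1 by rewrite ltr_pwDr// mulr_ge0.
have ed : 0 < e / (K * `|M| + 1) by rewrite divr_gt0.
near=> k.
apply: le_trans (g_lip _ _ Us) _.
have [h1 h2 h3] := qP k s sD.
have /andP[as_ sb] := sD.
have := y_lip' s (q k s) sD (introT andP (conj h1 (le_trans h2 sb))).
move=> /(ler_wpM2l K_ge0)/le_trans; apply.
rewrite (ger0_norm (_ : 0 <= s - q k s)) ?subr_ge0//.
apply: (@le_trans _ _ ((K * `|M| + 1) * k.+1%:R^-1)).
  by rewrite mulrA ler_pM ?mulr_ge0 ?subr_ge0// lerDl.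
rewrite -ler_pdivlMl// mulrC; apply: ltW; near: k.
exact: (near_infty_natSinv_lt (PosNum ed)).
Unshelve. all: by end_near. Qed.

End Measurability.

(** * Limits along an ultrafilter *)

Section UltraLimits.
Context {R : realType}.

Lemma le0_halving (B c : R) : (forall k, c <= B / 2 ^+ k) -> c <= 0.
Proof.
move=> h; rewrite leNgt; apply/negP => c0.
have B0 : 0 < B by have := h 0%N; rewrite expr0 divr1; exact: lt_le_trans.
have := h (Num.bound (B / c)); rewrite leNgt => /negP; apply.
rewrite ltr_pdivrMr ?exprn_gt0// -ltr_pdivrMl// mulrC.
apply: lt_le_trans (archi_boundP _) _; first by rewrite divr_ge0 ?ltW.
by rewrite -natrX ler_nat ltnW// ltn_expl.
Qed.

Lemma ultrafilter_nat : exists2 G : set_system nat, UltraFilter G &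
  forall N, G [set k | (N <= k)%N].
Proof.
have [G [GU sG]] := @ultraFilterLemma nat \oo _.
by exists G => // N; apply: sG; exists N.
Qed.

Variables (G : set_system nat) (GU : UltraFilter G).
Let GP : ProperFilter G := ultra_proper.

Definition ulim (E : normedModType R) (v : nat -> E) (l : E) :=
  forall e : R, 0 < e -> G [set k | `|v k - l| < e].

(** Compactness without extraction: along an ultrafilter every bounded sequence
    converges, so that uncountably many sequences (one for each time) converge
    together. *)
Lemma ulim_bounded q (v : nat -> 'rV[R]_q) (M : R) :
  (forall k, `|v k| <= M) -> exists l, ulim v l.
Proof.
move=> vM.
have cB : compact [set x : 'rV[R]_q | `|x| <= M].
  apply: bounded_closed_compact.
    exists M; split; first exact: num_real.
    by move=> x Mx y /= yM; apply: le_trans yM (ltW Mx).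
  move=> x /closure_normP cx; rewrite /=; apply/ler_addgt0Pr => e e0.
  have [y /= yM xy] := cx _ e0.
  rewrite -(subrK y x) addrC.
  by apply: le_trans (ler_normD _ _) _; rewrite lerD// ltW.
have FP : ProperFilter (fmap v G) by exact: fmap_proper_filter.
have [|l [_ vl]] := cB (fmap v G) FP.
  have : G [set k | `|v k| <= M] by apply: filterS filterT => k _ /=; exact: vM.
  exact.
exists l => e e0.
have [//|nG] := in_ultra_setVsetC [set k | `|v k - l| < e] GU.
have [|x [/= h1 h2]] := vl [set x | ~ `|x - l| < e] (ball l e) _ (nbhsx_ballx l e e0).
  exact: nG.
by exfalso; apply: h1; move: h2; rewrite -ball_normE/= distrC.
Qed.

Lemma ulim_le (E : normedModType R) (v v' : nat -> E) l l' (c : R) N :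
  ulim v l -> ulim v' l' -> (forall N, G [set k | (N <= k)%N]) ->
  (forall k, (N <= k)%N -> `|v k - v' k| <= c) -> `|l - l'| <= c.
Proof.
move=> vl vl' GN vc; apply/ler_addgt0Pr => e e0.
have e2 : 0 < e / 2 by rewrite divr_gt0.
have [k [[/= h1 h2] h3]] := filter_ex (filterI (filterI (vl _ e2) (vl' _ e2)) (GN N)).
have -> : l - l' = (l - v k) + (v k - v' k) + (v' k - l').
  by rewrite [l - v k + _]addrA subrK addrA subrK.
apply: le_trans (ler_normD _ _) _; apply: le_trans (lerD (ler_normD _ _) (lexx _)) _.
rewrite distrC in h1; have := vc _ h3; lra.
Qed.

Lemma ulimB (E : normedModType R) (v v' : nat -> E) l l' :
  ulim v l -> ulim v' l' -> ulim (fun k => v k - v' k) (l - l').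
Proof.
move=> vl vl' e e0; have e2 : 0 < e / 2 by rewrite divr_gt0.
apply: filterS (filterI (vl _ e2) (vl' _ e2)) => k [/= h1 h2].
rewrite opprB addrACA [- v' k + _]addrC.
have -> : v k + l' + (- l - v' k) = (v k - l) - (v' k - l').
  by rewrite opprB [RHS]addrACA addrACA [l' - v' k]addrC.
by apply: le_lt_trans (ler_normB _ _) _; lra.
Qed.

Lemma ulim_cst (E : normedModType R) (c : E) : ulim (fun=> c) c.
Proof. by move=> e e0; apply: filterS filterT => k _ /=; rewrite subrr normr0. Qed.

End UltraLimits.

(** * Fields, controls and primitives *)

Section Fields.
Context {R : realType} (n m : nat) (U : set 'rV[R]_m).
Notation mu := (@lebesgue_measure R).

Record regular_field q (g : 'rV[R]_n -> 'rV[R]_m -> 'rV[R]_q) (K M : R) : Prop :=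
  RegularField {
    rf_cont : {within [set: 'rV[R]_n] `*` U,
      continuous (fun xu : 'rV[R]_n * 'rV[R]_m => g xu.1 xu.2)};
    rf_K : 0 <= K;
    rf_M : 0 <= M;
    rf_lip : forall x1 x2 u, U u -> `|g x1 u - g x2 u| <= K * `|x1 - x2|;
    rf_bnd : forall x u, U u -> `|g x u| <= M }.

Definition control_on (a b : R) (u : R -> 'rV[R]_m) :=
  (forall s, a <= s <= b -> U (u s)) /\ lebesgue_measurable_fun `[a, b]%classic u.

Definition primitive q (g : 'rV[R]_n -> 'rV[R]_m -> 'rV[R]_q) (a : R)
    (y : R -> 'rV[R]_n) (u : R -> 'rV[R]_m) (s : R) : 'rV[R]_q :=
  \row_j (\int[@completed_lebesgue_measure R]_(r in `[a, s]) g (y r) (u r) ord0 j).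

(** Everything is checked coordinate by coordinate; the finitely many exceptional
    null sets are then put together. *)
Lemma primitiveP q (g : 'rV[R]_n -> 'rV[R]_m -> 'rV[R]_q) K M a b y u My :
  a <= b -> regular_field g K M -> control_on a b u -> lip_on a b My y ->
  [/\ primitive g a y u a = 0, lip_on a b M (primitive g a y u) &
    {ae mu, forall s, a < s < b ->
      has_deriv (primitive g a y u) s (g (y s) (u s))}].
Proof.
move=> ab [gc K0 M0 gl gb] [uU um] yl.
have H j : [/\ primitive g a y u a ord0 j = 0,
    lip_on a b M (fun s => primitive g a y u s ord0 j : R) &
    {ae mu, forall s, a < s < b ->
      has_deriv (fun s => primitive g a y u s ord0 j : R) s (g (y s) (u s) ord0 j : R)}].
  have gjc : {within [set: 'rV[R]_n] `*` U,
      continuous (fun xu : 'rV[R]_n * 'rV[R]_m => g xu.1 xu.2 ord0 j)}.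
    move=> x; exact: (@continuous_comp _ _ _ _ (fun w : 'rV[R]_q => w ord0 j) x (gc x)
      (@coord_continuous _ _ _ ord0 j _)).
  have gjl x1 x2 v : U v -> `|g x1 v ord0 j - g x2 v ord0 j| <= K * `|x1 - x2|.
    move=> Uv; apply: le_trans (gl x1 x2 v Uv).
    by have := norm_rV_coord (g x1 v - g x2 v) j; rewrite !mxE.
  have mg := @measurable_along _ _ _ _ _ gjc _ _ _ uU um _ _ _ K0 gjl yl.
  have gjb s : a <= s <= b -> `|g (y s) (u s) ord0 j| <= M.
    by move=> /uU Us; apply: le_trans (norm_rV_coord _ _) (gb _ _ Us).
  have := lebesgue_FTC ab mg gjb.
  have -> : (fun s => \int[@completed_lebesgue_measure R]_(r in `[a, s]) g (y r) (u r) ord0 j) =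
    (fun s => primitive g a y u s ord0 j).
    by apply/funext => s; rewrite mxE.
  by case.
split.
- by apply/rowP => j; rewrite [RHS]mxE; have [] := H j.
- move=> r s hr hs; apply: norm_rV_le; first by rewrite mulr_ge0.
  by move=> j; have [_ /(_ r s hr hs) h _] := H j; move: h; rewrite !mxE.
have : {ae mu, forall s, forall j, a < s < b ->
      has_deriv (fun s => primitive g a y u s ord0 j : R) s (g (y s) (u s) ord0 j : R)}.
  apply: (@filter_forall _ _ _ _ (ae_filter_ringOfSetsType mu)) => j.
  by have [] := H j.
by apply: ae_sub => s hs /= sab; apply: has_deriv_row => j; exact: hs.
Qed.

End Fields.

(** * Existence of trajectories for measurable controls *)

Section Existence.
Context {R : realType} (n m : nat) (U : set 'rV[R]_m).
Notation mu := (@lebesgue_measure R).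
Variables (f : 'rV[R]_n -> 'rV[R]_m -> 'rV[R]_n) (K M : R).
Hypothesis f_reg : regular_field U f K M.

Variables (a b : R) (ab : a <= b) (u : R -> 'rV[R]_m) (x : 'rV[R]_n).
Hypothesis u_ctl : control_on U a b u.

Let Phi (y : R -> 'rV[R]_n) (s : R) : 'rV[R]_n := x + primitive f a y u s.

Lemma picard_step y : lip_on a b M y ->
  [/\ Phi y a = x, lip_on a b M (Phi y) &
     {ae mu, forall s, a < s < b -> has_deriv (Phi y) s (f (y s) (u s))}].
Proof.
move=> yl; have [P0 Pl Pd] := primitiveP ab f_reg u_ctl yl.
split; first by rewrite /Phi P0 addr0.
  exact: lipD_cst.
by apply: ae_sub Pd => s hs /hs; exact: has_derivD_cst.
Qed.

(** The weight [expR (2 * K * (s - a))] grows twice as fast as the Lipschitz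
    constant requires, so that one Picard step halves weighted distances on the
    whole interval, whatever its length. *)
Lemma picard_contract (y1 y2 : R -> 'rV[R]_n) (A s : R) : 0 <= A ->
  lip_on a b M y1 -> lip_on a b M y2 ->
  (forall r, a <= r <= b -> `|y1 r - y2 r| <= A * expR (2 * K * (r - a))) ->
  a <= s <= b -> `|Phi y1 s - Phi y2 s| <= A / 2 * expR (2 * K * (s - a)).
Proof.
move=> A0 l1 l2 y12 /andP[as_ sb].
have [P1a P1l P1d] := picard_step l1; have [P2a P2l P2d] := picard_step l2.
have K0 := rf_K f_reg.
have := @exp_growth R _ a s (fun r => Phi y1 r - Phi y2 r) (A / 2) (2 * K) as_.
rewrite P1a P2a subrr subr0; apply.
- by rewrite divr_ge0.
- by rewrite mulr_ge0.
- exists (M + M); apply: lipB; [move: P1l|move: P2l] => pl r q /andP[ar rs] /andP[aq qs];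
    by apply: pl; apply/andP; split => //; apply: le_trans sb.
have := ae_and P1d P2d; apply: ae_sub => r [h1 h2] /andP[ar rs].
have rb : a < r < b by rewrite ar (lt_le_trans rs).
exists (f (y1 r) (u r) - f (y2 r) (u r)).
  by apply: has_derivB; [exact: h1|exact: h2].
have rb' : a <= r <= b by case/andP: rb => /ltW -> /ltW ->.
apply: le_trans (rf_lip f_reg _ _ (u_ctl.1 _ rb')) _.
have -> : A / 2 * (2 * K) * expR (2 * K * (r - a)) =
   K * (A * expR (2 * K * (r - a))) by field.
by rewrite ler_wpM2l// y12.
Qed.

(** The Picard iterates halve their weighted distances, hence converge; the
    limit is a fixed point of the iteration. *)
Theorem caratheodory_existence : exists y : R -> 'rV[R]_n,
  [/\ y a = x, lip_on a b M y &
     {ae mu, forall s, a < s < b -> has_deriv y s (f (y s) (u s))}].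
Proof.
have M0 := rf_M f_reg; have K0 := rf_K f_reg.
have p2 k : (2 ^+ k : R) != 0 by rewrite expf_neq0.
pose Y k := iter k Phi (fun=> x).
have Yl k : lip_on a b M (Y k).
  elim: k => [|k IH]; first exact: lip_cst.
  by have [] := picard_step IH.
have Ya k : Y k a = x by case: k => [//|k]; have [] := picard_step (Yl k).
(* The first two iterates differ by at most [A] everywhere. *)
have [A A0 AE] : exists2 A, 0 <= A & M * (b - a) = A.
  by exists (M * (b - a)); rewrite // mulr_ge0// subr_ge0.
pose ex s := expR (2 * K * (s - a)).
have ex1 s : a <= s -> 1 <= ex s.
  by move=> as_; rewrite -expR0 ler_expR !mulr_ge0// subr_ge0.
have ex0 s : 0 <= ex s by exact: expR_ge0.
have Yd k s : a <= s <= b -> `|Y k.+1 s - Y k s| <= A / 2 ^+ k * ex s.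
  elim: k s => [|k IH] s sab.
    rewrite expr0 divr1.
    have h := Yl 1%N s a sab (introT andP (conj (lexx a) ab)).
    have -> : Y 0%N s = Y 1%N a by rewrite Ya.
    apply: le_trans h _; case/andP: sab => as_ sb.
    rewrite ger0_norm ?subr_ge0//.
    apply: (@le_trans _ _ A); first by rewrite -AE ler_wpM2l// lerD2r.
    by rewrite -[leLHS]mulr1 ler_wpM2l// ex1.
  have -> : A / 2 ^+ k.+1 = A / 2 ^+ k / 2 by rewrite exprSr invfM mulrA.
  apply: (@picard_contract (Y k.+1) (Y k)) => //; first by rewrite divr_ge0// exprn_ge0.
have Ydd k j s : a <= s <= b -> `|Y (j + k)%N s - Y k s| <= 2 * A / 2 ^+ k * ex s.
  move=> sab.
  (* The geometric sum of the steps, with its remainder kept for the induction. *)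
  suff : `|Y (j + k)%N s - Y k s| <= (2 - 2 / 2 ^+ j) * (A / 2 ^+ k * ex s).
    move=> h; apply: le_trans h _.
    have -> : 2 * A / 2 ^+ k * ex s = 2 * (A / 2 ^+ k * ex s).
      by rewrite !mulrA.
    rewrite ler_wpM2r//; first by rewrite !mulr_ge0 ?invr_ge0 ?exprn_ge0 ?ex0.
    by rewrite gerBl mulr_ge0 ?invr_ge0 ?exprn_ge0.
  elim: j => [|j IH]; first by rewrite add0n subrr normr0 expr0 divr1 subrr mul0r.
  have -> : Y (j.+1 + k)%N s - Y k s =
      (Y (j + k).+1 s - Y (j + k)%N s) + (Y (j + k)%N s - Y k s).
    by rewrite addrA subrK.
  apply: le_trans (ler_normD _ _) _; apply: le_trans (lerD (Yd _ _ sab) IH) _.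
  have -> : A / 2 ^+ (j + k) * ex s = (1 / 2 ^+ j) * (A / 2 ^+ k * ex s).
    by rewrite exprD; field; rewrite ?p2.
  rewrite -mulrDl ler_wpM2r ?mulr_ge0 ?invr_ge0 ?exprn_ge0 ?ex0//.
  have -> : 2 / 2 ^+ j.+1 = 1 / 2 ^+ j :> R.
    by rewrite exprS; field; rewrite ?p2.
  have -> : 2 / 2 ^+ j = 2 * (1 / 2 ^+ j) :> R by rewrite mul1r.
  lra.
have [G GU GN] := ultrafilter_nat.
have /choice[y yP] : forall s, exists l, a <= s <= b -> ulim G (Y^~ s) l.
  move=> s; have [sab|] := boolP (a <= s <= b); last by exists 0.
  suff Yb k : `|Y k s| <= `|x| + A.
    by have [l Yl'] := @ulim_bounded _ _ GU _ (Y^~ s) _ Yb; exists l.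
  rewrite -[Y k s](subrK x) addrC.
  apply: le_trans (ler_normD _ _) _; rewrite lerD2l -(Ya k).
  have h := Yl k s a sab (introT andP (conj (lexx a) ab)).
  apply: le_trans h _; case/andP: sab => as_ sb.
  by rewrite -AE ger0_norm ?subr_ge0// ler_wpM2l// lerD2r.
have yY k s : a <= s <= b -> `|y s - Y k s| <= 2 * A / 2 ^+ k * ex s.
  move=> sab.
  apply: (@ulim_le _ _ GU _ (Y^~ s) (fun=> Y k s) _ _ _ k) => //.
  - exact: yP.
  - exact: ulim_cst.
  - by move=> j kj; rewrite -(subnK kj); exact: Ydd.
have yl : lip_on a b M y.
  move=> r s hr hs.
  have h := ulimB GU (yP r hr) (yP s hs).
  rewrite -[X in `|X|]subr0.
  apply: (@ulim_le _ _ GU _ _ (fun=> 0) _ _ _ 0%N h) => //.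
    exact: ulim_cst.
  by move=> k _; rewrite subr0; exact: Yl.
have [Pa Pl Pd] := picard_step yl.
have yE s : a <= s <= b -> Phi y s = y s.
  move=> sab; apply/eqP; rewrite -subr_eq0 -normr_le0.
  apply: (@le0_halving R (2 * A * ex s)) => k.
  rewrite -(subrK (Y k.+1 s) (Phi y s)) -addrA.
  apply: le_trans (ler_normD _ _) _.
  have h1 : `|Phi y s - Y k.+1 s| <= A / 2 ^+ k * ex s.
    have -> : A / 2 ^+ k = 2 * A / 2 ^+ k / 2 by field; rewrite ?p2.
    apply: (@picard_contract y (Y k)) => //.
      by rewrite divr_ge0 ?mulr_ge0 ?exprn_ge0.
    by move=> r hr; exact: yY.
  have h2 := yY k.+1 s sab; rewrite distrC in h2.
  have e2 : 2 * A / 2 ^+ k.+1 = A / 2 ^+ k.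
    by rewrite exprS; field; rewrite ?p2.
  rewrite e2 in h2.
  have -> : 2 * A * ex s / 2 ^+ k = A / 2 ^+ k * ex s + A / 2 ^+ k * ex s.
    by field; rewrite ?p2.
  exact: lerD.
exists y; split; [by rewrite -yE ?Pa// lexx|exact: yl|].
apply: ae_sub Pd => s hs sab.
by apply: has_deriv_itv (hs sab); [exact: sab|exact: yE].
Qed.

End Existence.

(** * Convex hulls and their closed neighbourhoods *)

Section Hulls.
Context {R : realType}.

Lemma hull_cvx (E : lmodType R) (A : set E) : cvx (convex_hull A).
Proof.
move=> x y k Ax Ay k01 B [/convex_setP cB AB].
have BP : convex_set B /\ A `<=` B by split => //; exact/convex_setP.
by apply: (cB x y k _ _ k01); [exact: (Ax B BP)|exact: (Ay B BP)].
Qed.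

Lemma sub_hull (E : lmodType R) (A : set E) : A `<=` convex_hull A.
Proof. by move=> x Ax B [_]; apply. Qed.

Lemma hull_min (E : lmodType R) (A B : set E) :
  cvx B -> A `<=` B -> convex_hull A `<=` B.
Proof. by move=> cB AB x; apply; split => //; exact/convex_setP. Qed.

Variable E : normedModType R.
Implicit Types (A B : set E).

(** The closed neighbourhood of radius [rho]. The slack [e] makes it closed even
    when the distance to [A] is not attained. *)
Definition thicken A (rho : R) : set E :=
  [set v | forall e : R, 0 < e -> exists2 c, A c & `|v - c| <= rho + e].

Lemma thicken_closed A rho : closed (thicken A rho).
Proof.
move=> x /closure_normP cx e e0; have e2 : 0 < e / 2 by rewrite divr_gt0.
have [y yA xy] := cx _ e2; have [c Ac yc] := yA _ e2.
exists c => //; have -> : x - c = (x - y) + (y - c) by rewrite addrA subrK.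
by apply: le_trans (ler_normD _ _) _; lra.
Qed.

Lemma thicken_cvx A rho : cvx A -> cvx (thicken A rho).
Proof.
move=> cA x y k xA yA k01 e e0.
have [c Ac xc] := xA _ e0; have [d Ad yd] := yA _ e0.
exists (k *: c + (1 - k) *: d); first exact: cA.
have -> : k *: x + (1 - k) *: y - (k *: c + (1 - k) *: d) =
    k *: (x - c) + (1 - k) *: (y - d).
  by rewrite !scalerBr opprD addrACA.
case/andP: k01 => k0 k1.
apply: le_trans (ler_normD _ _) _; rewrite !normrZ !ger0_norm ?subr_ge0//.
have : k * `|x - c| <= k * (rho + e) by rewrite ler_wpM2l.
have : (1 - k) * `|y - d| <= (1 - k) * (rho + e) by rewrite ler_wpM2l ?subr_ge0.
lra.
Qed.

Lemma thicken_le A (r1 r2 : R) : r1 <= r2 -> thicken A r1 `<=` thicken A r2.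
Proof.
move=> r12 v vA e e0; have [c Ac vc] := vA e e0; exists c => //.
by apply: le_trans vc _; rewrite lerD2r.
Qed.

(** A set near [B] has its closed convex hull near the hull of [B], because the
    thickening of a convex set is closed and convex. *)
Lemma hull_thicken A B (rho : R) :
  (forall x, A x -> exists2 y, B y & `|x - y| <= rho) ->
  closed_convex_hull A `<=` thicken (convex_hull B) rho.
Proof.
move=> AB x; have cl := @thicken_closed (convex_hull B) rho.
have /closure_id -> := cl; apply: closure_subset; apply: hull_min.
  by apply: thicken_cvx; exact: hull_cvx.
move=> y /AB[z Bz yz] e e0; exists z; first exact: sub_hull.
by apply: le_trans yz _; rewrite lerDl ltW.
Qed.

Lemma thicken0 A : thicken A 0 = closure A.
Proof.
apply/seteqP; split=> x h; [apply/closure_normP|move/closure_normP: h => h] => e e0.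
  have [c Ac xc] := h _ (divr_gt0 e0 (ltr0n _ 2)); exists c => //.
  by apply: le_lt_trans xc _; lra.
by have [c Ac /ltW xc] := h _ e0; exists c; rewrite // add0r.
Qed.

End Hulls.

(** * Relaxed trajectories are limits of trajectories *)

Section Relaxation.
Context {R : realType} (n m p : nat) (U : set 'rV[R]_m).
Notation mu := (@lebesgue_measure R).
Notation E := ('rV[R]_n * 'rV[R]_p)%type.

Lemma control_cat (a c b : R) u1 u2 : a <= c -> c <= b ->
  control_on U a c u1 -> control_on U c b u2 ->
  control_on U a b (fun s => if s < c then u1 s else u2 s).
Proof.
move=> ac cb [U1 m1] [U2 m2]; split.
  move=> s /andP[as_ sb]; case: ltP => sc; first by apply: U1; rewrite as_ ltW.
  by apply: U2; rewrite sc.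
have mi := @lebesgue_measurable_itv R.
have m1' : measurable_fun (`[a, c]%classic : set (lebesgueR R))
  (u1 : lebesgueR R -> borel_rV R m) := m1.
have m2' : measurable_fun (`[c, b]%classic : set (lebesgueR R))
  (u2 : lebesgueR R -> borel_rV R m) := m2.
move=> _ A mA.
have := measurableU _ _ (measurableI _ _ (mi `[a, c[) (m1' (mi _) A mA)) (m2' (mi _) A mA).
congr (measurable _); apply/seteqP; split => s /=; rewrite !in_itv/=.
  case=> [[/andP[as_ sc] [_ uA]]|[/andP[cs sb] uA]].
    by rewrite as_ sc (ltW (lt_le_trans sc cb)).
  by rewrite ltNge cs (le_trans ac).
case=> /andP[as_ sb]; case: ltP => sc uA.
  by left; rewrite as_ (ltW sc).
by right; rewrite sb.
Qed.

Lemma control_cst (a b : R) v : U v -> control_on U a b (fun=> v).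
Proof. by move=> Uv; split => // ; exact: measurable_cst. Qed.

Lemma control_sub (a b a' b' : R) u : a <= a' -> b' <= b ->
  control_on U a b u -> control_on U a' b' u.
Proof.
move=> aa bb [Uu um]; split.
  by move=> s /andP[h1 h2]; apply: Uu; rewrite (le_trans aa)// (le_trans h2).
have mi := @lebesgue_measurable_itv R.
have m' : measurable_fun (`[a, b]%classic : set (lebesgueR R))
  (u : lebesgueR R -> borel_rV R m) := um.
apply: (measurable_funS (mi _) _ m').
by move=> s /=; rewrite !in_itv/= => /andP[h1 h2]; rewrite (le_trans aa)// (le_trans h2).
Qed.

Variables (g : 'rV[R]_n -> 'rV[R]_m -> E) (K M : R).
Hypotheses (K_ge0 : 0 <= K) (M_ge0 : 0 <= M).
Hypothesis g_lip : forall x1 x2 u, U u -> `|g x1 u - g x2 u| <= K * `|x1 - x2|.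
Hypothesis U_neq0 : U !=set0.

Definition velocities (x : 'rV[R]_n) : set E := [set g x u | u in U].

(** The vector [c] is an average of velocities with frozen state [x] that some
    control realises on any given interval. The tolerance [rho] lets the definition
    speak of curves that only nearly follow the frozen field, as trajectories with
    a moving state do. *)
Definition average_of (x : 'rV[R]_n) (c : E) := forall a b : R, a <= b ->
  exists2 u, control_on U a b u & forall (W : R -> E) (rho : R), 0 <= rho ->
    absolutely_continuous a b W ->
    {ae mu, forall s, a < s < b ->
       exists2 v, has_deriv W s v & `|v - g x (u s)| <= rho} ->
    `|W b - W a - (b - a) *: c| <= rho * (b - a).

(** Using one control on a first part of the interval and another one on the
    rest averages velocities in proportion to the durations; so realisable averages
    form a convex set, and constant controls realise the velocities themselves. *)
Lemma average_of_hull x : convex_hull (velocities x) `<=` average_of x.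
Proof.
apply: hull_min; last first.
  move=> _ [v Uv <-] a b ab; exists (fun=> v); first exact: control_cst.
  by move=> W rho rho0 Wac dW; exact: mean_value_ball.
move=> c1 c2 k A1 A2 /andP[k0 k1] a b ab.
pose c := a + k * (b - a).
have ac : a <= c by rewrite lerDl mulr_ge0// subr_ge0.
have cb : c <= b.
  by rewrite /c -lerBrDl -[leRHS]mul1r ler_wpM2r// subr_ge0.
have [u1 ctl1 P1] := A1 _ _ ac; have [u2 ctl2 P2] := A2 _ _ cb.
exists (fun s => if s < c then u1 s else u2 s); first exact: control_cat.
move=> W rho rho0 Wac dW.
have h1 : `|W c - W a - (c - a) *: c1| <= rho * (c - a).
  apply: P1 => //; first exact: ac_sub Wac.
  apply: ae_sub dW => s h /andP[as_ sc].
  by have := h _; rewrite sc as_ (lt_le_trans sc cb) => /(_ isT).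
have h2 : `|W b - W c - (b - c) *: c2| <= rho * (b - c).
  apply: P2 => //; first exact: ac_sub Wac.
  apply: ae_sub dW => s h /andP[cs sb].
  by have := h _; rewrite [s < c]ltNge (ltW cs) (le_lt_trans ac cs) sb => /(_ isT).
have -> : W b - W a - (b - a) *: (k *: c1 + (1 - k) *: c2) =
    (W c - W a - (c - a) *: c1) + (W b - W c - (b - c) *: c2).
  rewrite scalerDr !scalerA.
  have -> : (b - a) * k = c - a by rewrite /c; ring.
  have -> : (b - a) * (1 - k) = b - c by rewrite /c; ring.
  by rewrite addrACA -opprD; congr (_ - _); rewrite addrC addrA subrK.
apply: le_trans (ler_normD _ _) _; lra.
Qed.

Definition relaxed_on (a b : R) (w : R -> E) := lip_on a b M w /\
  {ae mu, forall s, a < s < b -> exists2 v, has_deriv w s v &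
     closed_convex_hull (velocities (w s).1) v}.

Definition solution_on (a b : R) (u : R -> 'rV[R]_m) (W : R -> E) :=
  lip_on a b M W /\
  {ae mu, forall s, a < s < b -> has_deriv W s (g (W s).1 (u s))}.

(** One Euler step. Over a short interval the velocities of the relaxed curve
    stay near the hull at the initial state, hence so does its average velocity by
    the mean value theorem; a control realises a nearby element of that hull. *)
Lemma relaxed_step (a b eta : R) w : a <= b -> 0 < eta -> relaxed_on a b w ->
  exists2 u, control_on U a b u & forall W, solution_on a b u W ->
    `|W b - w b| <= (1 + K * (b - a)) * `|W a - w a| +
                    (b - a) * (2 * K * M * (b - a) + eta).
Proof.
move=> ab eta0 [wl dw].
have ba : 0 <= b - a by rewrite subr_ge0.
pose H := convex_hull (velocities (w a).1).
have aab : a <= a <= b by rewrite lexx.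
have [u0 Uu0] := U_neq0.
have H0 : H (g (w a).1 u0) by apply: sub_hull; exists u0.
have [d Dd wE] : exists2 d, thicken H (K * M * (b - a)) d & w b - w a = (b - a) *: d.
  apply: (mean_value ab (lip_ac wl)).
  - apply: thicken_cvx; exact: hull_cvx.
  - exact: thicken_closed.
  - exists (g (w a).1 u0) => e e0; exists (g (w a).1 u0) => //.
    by rewrite subrr normr0 addr_ge0 ?(ltW e0)// !mulr_ge0.
  apply: ae_sub dw => s h sab; have [v hv cv] := h sab; exists v => //.
  have /hull_thicken/(_ v cv) : forall x, velocities (w s).1 x -> exists2 y,
      velocities (w a).1 y & `|x - y| <= K * `|(w s).1 - (w a).1|.
    move=> _ [u Uu <-]; exists (g (w a).1 u); first by exists u.
    exact: g_lip.
  apply: thicken_le; rewrite -mulrA ler_wpM2l//.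
  have sab' : a <= s <= b by case/andP: sab => /ltW -> /ltW ->.
  apply: le_trans (le_trans (norm_fst_le (w s - w a)) (wl s a sab' aab)) _.
  case/andP: sab' => as_ sb.
  by rewrite ger0_norm ?subr_ge0// ler_wpM2l// lerD2r.
have [c Hc dc] := Dd _ eta0.
have [u uctl uP] := average_of_hull Hc ab.
exists u => // W [Wl dW].
pose rho := K * (`|W a - w a| + M * (b - a)).
have rho0 : 0 <= rho by rewrite mulr_ge0// addr_ge0// mulr_ge0.
have h1 : `|W b - W a - (b - a) *: c| <= rho * (b - a).
  apply: uP => //; first exact: lip_ac Wl.
  apply: ae_sub dW => s h sab; exists (g (W s).1 (u s)); first exact: h.
  have sab' : a <= s <= b by case/andP: sab => /ltW -> /ltW ->.
  apply: le_trans (g_lip _ _ (uctl.1 _ sab')) _; rewrite ler_wpM2l//.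
  have -> : (W s).1 - (w a).1 = ((W s) - (W a) + ((W a) - (w a))).1.
    by rewrite addrA subrK.
  apply: le_trans (norm_fst_le _) _; apply: le_trans (ler_normD _ _) _.
  rewrite addrC lerD2l; apply: le_trans (Wl _ _ sab' aab) _.
  case/andP: sab' => as_ sb.
  by rewrite ger0_norm ?subr_ge0// ler_wpM2l// lerD2r.
have h2 : `|w b - w a - (b - a) *: c| <= (b - a) * (K * M * (b - a) + eta).
  by rewrite wE -scalerBr normrZ ger0_norm// ler_wpM2l.
have -> : W b - w b = (W b - W a - (b - a) *: c) - (w b - w a - (b - a) *: c) +
    (W a - w a).
  rewrite [w b - w a - _]addrC opprD opprK [W b - W a - _ + _]addrA subrK.
  by rewrite !opprD !opprK [X in X + (W a - w a)]addrACA [- W a + _]addrC -[w a - W a]opprB subrK.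
apply: le_trans (ler_normD _ _) _.
apply: le_trans (lerD (ler_normB _ _) (lexx _)) _.
apply: le_trans (lerD (lerD h1 h2) (lexx _)) _.
rewrite /rho le_eqVlt; apply/orP; left; apply/eqP; ring.
Qed.

Lemma solution_sub (a b a' b' : R) u W : a <= a' -> b' <= b ->
  solution_on a b u W -> solution_on a' b' u W.
Proof.
move=> aa bb [Wl dW]; split.
  move=> r s /andP[h1 h2] /andP[h3 h4]; apply: Wl; apply/andP; split;
    by [apply: le_trans aa _|apply: le_trans bb].
by apply: ae_sub dW => s h /andP[h1 h2]; apply: h;
  rewrite (le_lt_trans aa) ?(lt_le_trans _ bb).
Qed.

Lemma solution_eq_control (a b : R) u u' W :
  (forall s, a < s < b -> u s = u' s) -> solution_on a b u W -> solution_on a b u' W.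
Proof.
move=> uu [Wl dW]; split; first exact: Wl.
by apply: ae_sub dW => s h sab; rewrite -(uu s sab); exact: (h sab).
Qed.

Lemma relaxed_sub (a b a' b' : R) w : a <= a' -> b' <= b ->
  relaxed_on a b w -> relaxed_on a' b' w.
Proof.
move=> aa bb [Wl dW]; split.
  move=> r s /andP[h1 h2] /andP[h3 h4]; apply: Wl; apply/andP; split;
    by [apply: le_trans aa _|apply: le_trans bb].
by apply: ae_sub dW => s h /andP[h1 h2]; apply: h;
  rewrite (le_lt_trans aa) ?(lt_le_trans _ bb).
Qed.

(** The errors of the successive steps accumulate as in a discrete Gronwall
    inequality. *)
Lemma relaxed_steps (a h eta : R) (i : nat) w : 0 <= h -> 0 < eta ->
  relaxed_on a (a + i%:R * h) w ->
  exists2 u, control_on U a (a + i%:R * h) u &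
  forall W, solution_on a (a + i%:R * h) u W -> W a = w a ->
    `|W (a + i%:R * h) - w (a + i%:R * h)| <=
    i%:R * (h * (2 * K * M * h + eta)) * (1 + K * h) ^+ i.
Proof.
move=> h0 eta0; have [v Uv] := U_neq0.
have Kh : 0 <= K * h by rewrite mulr_ge0.
have B0 : 0 <= h * (2 * K * M * h + eta).
  by rewrite mulr_ge0// addr_ge0 ?(ltW eta0)// !mulr_ge0.
elim: i => [|i IH] wr.
  exists (fun=> v); first exact: control_cst.
  by move=> W _ Wa; rewrite !mul0r addr0 Wa subrr normr0.
set c := a + i%:R * h in IH *; set b := a + i.+1%:R * h in wr *.
have ac : a <= c by rewrite lerDl mulr_ge0.
have bE : b - c = h by rewrite /b /c -natr1; ring.
have cb : c <= b by rewrite -subr_ge0 bE.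
have [u1 ctl1 P1] := IH (relaxed_sub (lexx a) cb wr).
have [u2 ctl2 P2] := relaxed_step cb eta0 (relaxed_sub ac (lexx b) wr).
exists (fun s => if s < c then u1 s else u2 s); first exact: control_cat.
move=> W Ws Wa.
have W1 : solution_on a c u1 W.
  apply: solution_eq_control (solution_sub (lexx a) cb Ws).
  by move=> s /andP[_ ->].
have W2 : solution_on c b u2 W.
  apply: solution_eq_control (solution_sub ac (lexx b) Ws).
  by move=> s /andP[/ltW]; rewrite leNgt => /negbTE ->.
have h1 := P1 W W1 Wa; have := P2 W W2; rewrite bE => h2.
apply: le_trans h2 _.
set B := h * _ in B0 h1 *.
set q := 1 + K * h in h1 *.
have q1 : 1 <= q by rewrite lerDl.
have q0 : 0 <= q by apply: le_trans q1.
apply: (@le_trans _ _ (q * (i%:R * B * q ^+ i) + B * q ^+ i.+1)).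
  apply: lerD; first by rewrite ler_wpM2l.
  by rewrite -[leLHS]mulr1 ler_wpM2l// exprn_ege1.
by rewrite exprS -natr1 le_eqVlt; apply/orP; left; apply/eqP; ring.
Qed.

(** Filippov-Wazewski relaxation for one trajectory. A step of length
    [(b - a) / N] contributes an error of order [N^-2], so that [N] steps give an
    error of order [N^-1]. *)
Theorem relaxation (a b e : R) w : a <= b -> 0 < e -> relaxed_on a b w ->
  exists2 u, control_on U a b u &
  forall W, solution_on a b u W -> W a = w a -> `|W b - w b| <= e.
Proof.
move=> ab e0 wr.
have ba : 0 <= b - a by rewrite subr_ge0.
(* The total error is at most [B / N], where [expR (K * (b - a))] bounds the
   growth factor [(1 + K * h) ^+ N]. *)
pose B := (b - a) * (2 * K * M * (b - a) + 1) * expR (K * (b - a)).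
have B0 : 0 <= B.
  rewrite mulr_ge0 ?expR_ge0// mulr_ge0// addr_ge0// !mulr_ge0//.
pose N := (Num.bound (B / e)).+1.
have N0 : 0 < N%:R :> R by rewrite ltr0n.
have BN : B / N%:R <= e.
  rewrite ler_pdivrMr// -ler_pdivrMl// mulrC; apply: ltW.
  apply: lt_le_trans (archi_boundP _) _; first by rewrite divr_ge0// ltW.
  by rewrite ler_nat.
pose h := (b - a) / N%:R.
have h0 : 0 <= h by rewrite divr_ge0// ltW.
have Nh : N%:R * h = b - a by rewrite /h mulrC divfK// gt_eqF.
have bE : a + N%:R * h = b by rewrite Nh addrC subrK.
have iN0 : 0 < N%:R^-1 :> R by rewrite invr_gt0.
have := @relaxed_steps a h N%:R^-1 N w h0 iN0; rewrite bE => /(_ wr)[u uctl uP].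
exists u => // W Ws Wa; apply: le_trans (uP W Ws Wa) _; apply: le_trans BN.
have -> : N%:R * (h * (2 * K * M * h + N%:R^-1)) =
    (b - a) * (2 * K * M * (b - a) + 1) / N%:R.
  by rewrite mulrA Nh /h; ring.
rewrite /B mulrAC ler_wpM2r ?invr_ge0 ?(ltW N0)// ler_wpM2l//.
  by rewrite mulr_ge0// addr_ge0// !mulr_ge0.
apply: (@le_trans _ _ (expR (K * h) ^+ N)).
  by rewrite lerXn2r ?nnegrE ?expR_ge0 ?addr_ge0 ?mulr_ge0// expR_ge1Dx.
by rewrite -expRM_natl mulrCA Nh.
Qed.

End Relaxation.

(** * Translation of null sets *)

Section Shift.
Context {R : realType}.
Notation mu := (@lebesgue_measure R).

(** Translated intervals keep their length, and lengths of intervals determine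
    the measure. *)
Lemma lebesgue_measure_shift (c : R) (A : set (measurableTypeR R)) :
  measurable A -> mu ((fun s : R => c + s) @^-1` A) = mu A.
Proof.
move=> mA.
have mc : measurable_fun setT ((fun s => c + s) : measurableTypeR R -> measurableTypeR R).
  by apply: measurable_funD; [exact: measurable_cst|exact: measurable_id].
pose phi : {mfun measurableTypeR R >-> measurableTypeR R} :=
  HB.pack ((fun s => c + s) : measurableTypeR R -> measurableTypeR R)
    (isMeasurableFun.Build _ _ _ _ _ mc).
rewrite [RHS](@lebesgue_measure_unique _ (pushforward mu phi))//.
move=> _ [[x y] _ <-]/=; rewrite /pushforward.
have -> : phi @^-1` `]x, y]%classic = `]x - c, y - c]%classic.
  by apply/seteqP; split=> s /=; rewrite !in_itv/= ltrBlDl lerBrDl.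
rewrite !lebesgue_measure_itv/= !lte_fin ltrD2r.
by case: ifP => // _; rewrite -!EFinB; congr (_%:E); ring.
Qed.

Lemma ae_shift (c : R) (P : R -> Prop) :
  {ae mu, forall s, P s} -> {ae mu, forall s, P (c + s)}.
Proof.
move=> [A [mA A0 PA]]; exists ((fun s : R => c + s) @^-1` A); split.
- have mc : measurable_fun setT ((fun s => c + s) : measurableTypeR R -> measurableTypeR R).
    by apply: measurable_funD; [exact: measurable_cst|exact: measurable_id].
  by rewrite -[X in measurable X]setTI; exact: mc.
- by rewrite lebesgue_measure_shift.
- by move=> s /= h; apply: PA.
Qed.

End Shift.

(** * Freezing a curve outside an interval *)

Section Clamp.
Context {R : realType} (a b : R).
Hypothesis ab : a <= b.

Definition clamp (s : R) := Num.max a (Num.min s b).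

Lemma clamp_itv s : a <= clamp s <= b.
Proof. by rewrite /clamp le_max lexx/= ge_max ab ge_min lexx orbT. Qed.

Lemma clampE s : a <= s <= b -> clamp s = s.
Proof. by move=> /andP[as_ sb]; rewrite /clamp (min_idPl sb) (max_idPr as_). Qed.

Lemma clamp_lip r s : `|clamp r - clamp s| <= `|r - s|.
Proof.
wlog rs : r s / r <= s.
  move=> H; have [/H//|/ltW/H] := leP r s.
  by rewrite distrC [leRHS]distrC.
rewrite distrC [leRHS]distrC (ger0_norm (_ : 0 <= s - r)) ?subr_ge0//.
have mn : Num.min r b <= Num.min s b by rewrite le_min !ge_min rs lexx orbT.
rewrite ger0_norm; last first.
  by rewrite subr_ge0 /clamp ge_max le_max lexx/= le_max mn orbT.
have min_lip : Num.min s b - Num.min r b <= s - r.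
  have [sb|sb] := leP s b; first by rewrite (min_idPl (le_trans rs sb)).
  by have [rb|rb] := leP r b; lra.
apply: le_trans min_lip; rewrite /clamp.
move: (Num.min r b) (Num.min s b) mn => x y xy.
have [ax|ax] := leP a x; first by rewrite (max_idPr (le_trans ax xy)).
by have [ay|ay] := leP a y; lra.
Qed.

Lemma lip_clamp (E : normedModType R) (M : R) (w : R -> E) : 0 <= M ->
  lip_on a b M w -> forall r s, `|w (clamp r) - w (clamp s)| <= M * `|r - s|.
Proof.
move=> M0 wl r s; apply: le_trans (wl _ _ (clamp_itv r) (clamp_itv s)) _.
by rewrite ler_wpM2l// clamp_lip.
Qed.

End Clamp.

(** * Limits of trajectories are relaxed trajectories *)

Section Compactness.
Context {R : realType} (n m p : nat) (U : set 'rV[R]_m).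
Notation mu := (@lebesgue_measure R).
Notation E := ('rV[R]_n * 'rV[R]_p)%type.
Variables (g : 'rV[R]_n -> 'rV[R]_m -> E) (K M : R).
Hypotheses (K_ge0 : 0 <= K) (M_ge0 : 0 <= M).
Hypothesis g_lip : forall x1 x2 u, U u -> `|g x1 u - g x2 u| <= K * `|x1 - x2|.
Hypothesis U_neq0 : U !=set0.

Lemma rV_lip_ae_derivable q (w : R -> 'rV[R]_q) (a b : R) :
  (forall r s, `|w r - w s| <= M * `|r - s|) ->
  {ae mu, forall s, a < s < b -> exists v, has_deriv w s v}.
Proof.
move=> wl.
have : {ae mu, forall s, forall j : 'I_q, a < s < b ->
      exists v : R, has_deriv (fun r => w r ord0 j : R) s v}.
  apply: (@filter_forall _ _ _ _ (ae_filter_ringOfSetsType mu)) => j.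
  apply: (@lipschitz_ae_derivable _ _ M) => r s.
  by apply: le_trans (wl r s); have := norm_rV_coord (w r - w s) j; rewrite !mxE.
apply: ae_sub => s h sab.
have /choice[v vP] : forall j : 'I_q, exists v : R,
    has_deriv (fun r => w r ord0 j : R) s v by move=> j; exact: h.
by exists (\row_j v j); apply: has_deriv_row => j; rewrite mxE.
Qed.

Variables (G : set_system nat) (GU : UltraFilter G).
Let GP : ProperFilter G := ultra_proper.
Hypothesis GN : forall N, G [set k | (N <= k)%N].

(** Over a short time [h] after [s], the average velocity of every curve [W k]
    lies in a small neighbourhood of the hull at the state of [w] at time [s], by
    the mean value theorem. Closed neighbourhoods survive the limit in [k], and then
    [h] tends to [0]. *)
Lemma ulim_velocity (a b : R) (u : nat -> R -> 'rV[R]_m) (W : nat -> R -> E)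
    (w : R -> E) s v :
  (forall k, control_on U a b (u k)) ->
  (forall k, solution_on g M a b (u k) (W k)) ->
  (forall r, a <= r <= b -> ulim G (W^~ r) (w r)) ->
  a < s < b -> has_deriv w s v ->
  closed_convex_hull (velocities U g (w s).1) v.
Proof.
move=> uc Ws wW /andP[as_ sb] wv.
rewrite /closed_convex_hull -thicken0 => e e0.
(* Five errors of size [e1] arise: one from the derivative of [w], one from the
   distance of [W k] to [w], two from the drift of the state, and one from the
   thickening. *)
pose e1 := e / 8.
have e10 : 0 < e1 by rewrite divr_gt0.
have [d d0 dP] := wv _ e10.
have KM0 : 0 < K * M + 1 by rewrite ltr_pwDr// mulr_ge0.
pose h := Num.min (d / 2) (Num.min ((b - s) / 2) (e1 / (K * M + 1))).
have h0 : 0 < h by rewrite !lt_min !divr_gt0// subr_gt0.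
have hd : `|h| < d.
  by rewrite gtr0_norm// /h gt_min; apply/orP; left; lra.
have hb : s + h <= b.
  have : h <= (b - s) / 2 by rewrite /h !ge_min lexx orbT.
  lra.
have hK : K * (M * h) <= e1.
  have h1 : h <= e1 / (K * M + 1) by rewrite /h !ge_min lexx !orbT.
  rewrite mulrA; apply: (@le_trans _ _ ((K * M + 1) * h)).
    by rewrite ler_wpM2r ?(ltW h0)// lerDl.
  by rewrite -ler_pdivlMl// mulrC.
have K1 : 0 < K + 1 by rewrite ltr_pwDr.
(* The curve [W k] must be close to [w] on the scale of [h], since increments are
   divided by [h]. *)
pose eta := Num.min (e1 * h / 2) (e1 / (K + 1)).
have eta0 : 0 < eta by rewrite lt_min !divr_gt0// mulr_gt0.
have sab : a <= s <= b by rewrite !ltW.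
have shab : a <= s + h <= b by rewrite hb andbT; apply: (le_trans (ltW as_)); rewrite lerDl ltW.
have [k [/= k1 k2]] := filter_ex (filterI (wW _ sab _ eta0) (wW _ shab _ eta0)).
pose H := convex_hull (velocities U g (w s).1).
have [u0 Uu0] := U_neq0.
have [Wl dW] := Ws k.
have ssh : s <= s + h by rewrite lerDl ltW.
have h0' := ltW h0; have eta0' := ltW eta0.
have rho0 : 0 <= K * (M * h + eta) by rewrite mulr_ge0// addr_ge0// mulr_ge0.
have lW : lip_on s (s + h) M (W k).
  move=> r q /andP[r1 r2] /andP[q1 q2]; apply: Wl; apply/andP; split.
  - exact: le_trans (ltW as_) r1.
  - exact: le_trans r2 hb.
  - exact: le_trans (ltW as_) q1.
  - exact: le_trans q2 hb.
have [c Hc Wc] : exists2 c, thicken H (K * (M * h + eta)) c &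
    W k (s + h) - W k s = (s + h - s) *: c.
  apply: (mean_value ssh (lip_ac lW)).
  - apply: thicken_cvx; exact: hull_cvx.
  - exact: thicken_closed.
  - exists (g (w s).1 u0) => e' e'0; exists (g (w s).1 u0).
      by apply: sub_hull; exists u0.
    by rewrite subrr normr0 addr_ge0 ?(ltW e'0).
  apply: ae_sub dW => r hr /andP[sr rsh].
  have rab : a < r < b by rewrite (lt_trans as_ sr) (lt_le_trans rsh hb).
  have rab' : a <= r <= b by case/andP: rab => /ltW -> /ltW ->.
  have Ur := (uc k).1 r rab'.
  exists (g (W k r).1 (u k r)); first exact: hr.
  move=> e' e'0; exists (g (w s).1 (u k r)).
    by apply: sub_hull; exists (u k r).
  apply: le_trans (g_lip _ _ Ur) _.
  apply: (@le_trans _ _ (K * (M * h + eta))); last by rewrite lerDl ltW.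
  rewrite ler_wpM2l//.
  have -> : (W k r).1 - (w s).1 = ((W k r - W k s) + (W k s - w s)).1.
    by rewrite addrA subrK.
  apply: le_trans (norm_fst_le _) _; apply: le_trans (ler_normD _ _) _.
  apply: lerD; last exact: ltW.
  apply: le_trans (Wl _ _ rab' sab) _; rewrite ler_wpM2l//.
  by rewrite ger0_norm ?subr_ge0 ?(ltW sr)// lerBlDl ltW.
have [c' Hc' cc'] := Hc _ e10.
exists c' => //; rewrite add0r.
have shE : s + h - s = h by rewrite addrC addKr.
rewrite shE in Wc.
have vc : `|v - c| <= 2 * e1.
  rewrite -(ler_pM2l h0) -[X in X * `|_|](gtr0_norm h0) -normrZ scalerBr -Wc.
  have -> : h *: v - (W k (s + h) - W k s) =
     - (w (s + h) - w s - h *: v) - ((W k (s + h) - w (s + h)) - (W k s - w s)).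
    have -> : (W k (s + h) - w (s + h)) - (W k s - w s) =
        (W k (s + h) - W k s) - (w (s + h) - w s).
      by rewrite !opprD !opprK addrACA.
    move: (w (s + h) - w s) (W k (s + h) - W k s) => q Q.
    by rewrite !opprB addrA subrK.
  have dh := dP _ hd; rewrite (gtr0_norm h0) in dh.
  apply: le_trans (ler_normB _ _) _; rewrite normrN.
  apply: le_trans (lerD dh (ler_normB _ _)) _.
  have : eta <= e1 * h / 2 by rewrite /eta ge_min lexx.
  lra.
have Keta : K * eta <= e1.
  have h1 : eta <= e1 / (K + 1) by rewrite /eta ge_min lexx orbT.
  apply: (@le_trans _ _ ((K + 1) * eta)).
    by rewrite ler_wpM2r ?(ltW eta0)// lerDl.
  by rewrite -ler_pdivlMl// mulrC.
have -> : v - c' = (v - c) + (c - c') by rewrite addrA subrK.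
apply: le_trans (ler_normD _ _) _.
rewrite mulrDr in cc'; rewrite /e1 in cc' vc hK Keta; lra.
Qed.

(** The curves converge pointwise along the ultrafilter. Their common Lipschitz
    bound holds for the limit, which is therefore differentiable almost everywhere. *)
Theorem solutions_compact (a b : R) (u : nat -> R -> 'rV[R]_m) (W : nat -> R -> E) (w0 : E) :
  a <= b ->
  (forall k, control_on U a b (u k)) ->
  (forall k, solution_on g M a b (u k) (W k)) ->
  (forall k, W k a = w0) ->
  exists2 w, relaxed_on U g M a b w &
    forall r, a <= r <= b -> ulim G (W^~ r) (w r).
Proof.
move=> ab uc Ws Wa.
have Wl k := (Ws k).1.
have aab : a <= a <= b by rewrite lexx.
have Wbd k r : a <= r <= b -> `|W k r| <= M * (b - a) + `|w0|.
  move=> rab; rewrite -(subrK (W k a) (W k r)).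
  apply: le_trans (ler_normD _ _) _; rewrite {2}Wa lerD2r.
  apply: le_trans (Wl k r a rab aab) _; rewrite ler_wpM2l//.
  by case/andP: rab => ar rb; rewrite ger0_norm ?subr_ge0// lerD2r.
have cab r := clamp_itv ab r.
have /choice[w wP] : forall r, exists l : E, ulim G (fun k => W k (clamp a b r)) l.
  move=> r.
  have b1 k : `|(W k (clamp a b r)).1| <= M * (b - a) + `|w0|.
    by apply: le_trans (norm_fst_le _) (Wbd k _ (cab r)).
  have b2 k : `|(W k (clamp a b r)).2| <= M * (b - a) + `|w0|.
    by apply: le_trans (norm_snd_le _) (Wbd k _ (cab r)).
  have [l1 L1] := ulim_bounded GU b1; have [l2 L2] := ulim_bounded GU b2.
  exists (l1, l2) => e e0; apply: filterS (filterI (L1 e e0) (L2 e e0)).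
  by move=> k [/= h1 h2]; rewrite norm_pairE gt_max; apply/andP.
have wlim r : a <= r <= b -> ulim G (W^~ r) (w r).
  by move=> rab; have := wP r; rewrite clampE.
have wl r s : `|w r - w s| <= M * `|r - s|.
  rewrite -[X in `|X|]subr0.
  apply: (@ulim_le _ _ GU _ _ (fun=> 0) _ _ _ 0%N (ulimB GU (wP r) (wP s))) => //.
    exact: ulim_cst.
  by move=> k _; rewrite subr0; exact: (lip_clamp ab M_ge0 (Wl k)).
exists w => //; split; first by move=> r s _ _; exact: wl.
have d1 := @rV_lip_ae_derivable _ (fun r => (w r).1) a b
  (fun r s => le_trans (norm_fst_le (w r - w s)) (wl r s)).
have d2 := @rV_lip_ae_derivable _ (fun r => (w r).2) a b
  (fun r s => le_trans (norm_snd_le (w r - w s)) (wl r s)).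
have := ae_and d1 d2; apply: ae_sub => s [h1 h2] sab.
have [v1 V1] := h1 sab; have [v2 V2] := h2 sab.
have wv : has_deriv w s (v1, v2).
  have wE : (fun r => ((w r).1, (w r).2)) = w by apply/funext => r; case: (w r).
  by have := has_deriv_pair V1 V2; rewrite wE.
exists (v1, v2); first exact: wv.
exact: (ulim_velocity uc Ws wlim sab wv).
Qed.

End Compactness.

(** * Efficient points of compact sets *)

Section Pareto.
Context {R : realType} (p : nat).

(** Among the points of [S] below [y], one that minimises the sum of the
    coordinates is efficient: a point below it would have a smaller sum. *)
Lemma pareto_below (S : set 'rV[R]_p) (y : 'rV[R]_p) : compact S -> S y ->
  exists2 v, pareto S v & orthant (y - v).
Proof.
move=> cS Sy.
pose A := S `&` [set v | forall j, v ord0 j <= y ord0 j].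
pose F (v : 'rV[R]_p) : R := \sum_j v ord0 j.
have cA : compact A.
  apply: compact_closedI => //.
  move=> x /closure_normP cx j; apply/ler_addgt0Pr => e e0.
  have [v /= vy xv] := cx _ e0.
  have := norm_rV_coord (x - v) j; rewrite !mxE ler_norml => /andP[_ h].
  have := vy j; lra.
have cF : continuous F.
  apply: (continuous_big (x0 := 0 : R)); first exact: add_continuous.
  by move=> j _; exact: coord_continuous.
have A0 : A !=set0 by exists y; split => //= j.
have [v Av vmin] : exists2 v, A v & forall v', A v' -> F v <= F v'.
  have [v vA vmin] := compact_EVT_min A0 cA (continuous_subspaceT cF).
  exists v; first by rewrite inE in vA.
  by move=> v' Av'; apply: vmin; rewrite inE.
exists v.
  split; first exact: Av.1.
  move=> [y2 [Sy2 y2v [w w0 /= y2w]]]; apply: y2v.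
  have Ay2 : A y2.
    split => //= j; apply: le_trans (Av.2 j).
    by rewrite -y2w mxE lerDl.
  have := vmin _ Ay2; rewrite -y2w /F.
  under eq_bigr do rewrite mxE.
  rewrite big_split/= gerDl => sw.
  have w00 j : w ord0 j = 0.
    have : \sum_j w ord0 j = 0.
      by apply/eqP; rewrite eq_le sw sumr_ge0// => i _; exact: w0.
    by move=> /psumr_eq0P; apply => // i _; exact: w0.
  by apply/rowP => j; rewrite mxE w00 addr0.
by move=> j; rewrite !mxE subr_ge0; exact: Av.2.
Qed.

End Pareto.

(** * The two inclusions *)

Section ControlProblem.
Context {R : realType} (n m p : nat).
Notation mu := (@lebesgue_measure R).
Notation E := ('rV[R]_n * 'rV[R]_p)%type.
Variables (T : R) (U : set 'rV[R]_m).
Variables (f : 'rV[R]_n -> 'rV[R]_m -> 'rV[R]_n).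
Variables (L : 'rV[R]_n -> 'rV[R]_m -> 'rV[R]_p) (Kf Mf KL ML : R).
Hypotheses (f_reg : regular_field U f Kf Mf) (L_reg : regular_field U L KL ML).
Hypotheses (U_neq0 : U !=set0) (U_compact : compact U).

Definition expanded_velocity (x : 'rV[R]_n) (u : 'rV[R]_m) : E := (f x u, - L x u).
Local Notation g := expanded_velocity.
Let K := Num.max Kf KL.
Let M := Num.max Mf ML.

Let K0 : 0 <= K. Proof. by rewrite le_max (rf_K f_reg). Qed.
Let M0 : 0 <= M. Proof. by rewrite le_max (rf_M f_reg). Qed.

Lemma expanded_velocity_lip x1 x2 u : U u -> `|g x1 u - g x2 u| <= K * `|x1 - x2|.
Proof.
move=> Uu; rewrite /g norm_pairE/= ge_max -opprD normrN.
apply/andP; split.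
  by apply: le_trans (rf_lip f_reg _ _ Uu) _; rewrite ler_wpM2r// le_max lexx.
by apply: le_trans (rf_lip L_reg _ _ Uu) _; rewrite ler_wpM2r// le_max lexx orbT.
Qed.

Lemma expanded_velocity_bnd x u : U u -> `|g x u| <= M.
Proof.
move=> Uu; rewrite /g norm_pairE/= normrN ge_max /M !le_max.
by rewrite (rf_bnd f_reg)// (rf_bnd L_reg)// orbT.
Qed.

Lemma FLminusE x : FLminus U f L x = closed_convex_hull (velocities U g x).
Proof.
rewrite /FLminus; congr closed_convex_hull.
by apply/seteqP; split=> [_ [u Uu ->]|_ [u Uu <-]]; exists u.
Qed.

Lemma FLminus_bnd x v : FLminus U f L x v -> `|v| <= M.
Proof.
rewrite FLminusE => vx; apply/ler_addgt0Pr => e e0.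
suff /(_ e e0)[_ -> ] : thicken [set (0 : E)] M v by rewrite subr0.
move: v vx; have cl := @thicken_closed _ E [set 0] M.
have /closure_id -> := cl; apply: closure_subset; apply: hull_min.
  apply: thicken_cvx => x1 x2 k -> -> _.
  by rewrite !scaler0 addr0.
move=> _ [u Uu <-] e' e'0; exists 0 => //; rewrite subr0.
by apply: le_trans (expanded_velocity_bnd _ Uu) _; rewrite lerDl ltW.
Qed.

Lemma controlsP u : controls T U u <-> control_on U 0 T u.
Proof.
split=> [[Uu _ um]|[Uu um]].
  by split => // s s0T; apply: Uu; rewrite /= in_itv.
have Uu' s : `[0, T]%classic s -> U (u s) by rewrite /= in_itv; exact: Uu.
split => //.
have [B [Br BU]] := compact_bounded U_compact.
by exists B; split => // x Bx s /Uu'; exact: BU.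
Qed.

(** A trajectory exists, so the chosen one solves the equation; its velocities
    are bounded, so that it is Lipschitz and not merely absolutely continuous. *)
Lemma trajectoryP t x u : 0 <= t <= T -> control_on U 0 T u ->
  let y := trajectory T f t x u in
  [/\ y t = x, lip_on t T Mf y &
    {ae mu, forall s, t < s < T -> has_deriv y s (f (y s) (u s))}].
Proof.
move=> /andP[t0 tT] uc y.
have uc' : control_on U t T u by exact: control_sub uc.
have [y' [y't y'l y'd]] := caratheodory_existence f_reg tT x uc'.
have : is_trajectory T f t x u y.
  apply: (@xgetPex _ (cst x) [set y | is_trajectory T f t x u y]); exists y'.
  split => //; first exact: lip_ac y'l.
  have := ae_and (ae_and (ae_neq t) (ae_neq T)) y'd; apply: ae_sub.
  move=> s [[/eqP st /eqP sT] hs]; rewrite /= in_itv/= => /andP[ts sT'].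
  by apply/has_derivP; apply: hs; rewrite !lt_neqAle eq_sym st ts sT.
move=> [yt yac yd].
have yd' : {ae mu, forall s, t < s < T -> has_deriv y s (f (y s) (u s))}.
  apply: ae_sub yd => s hs /andP[ts sT]; apply/has_derivP; apply: hs.
  by rewrite /= in_itv/= !ltW.
split => //; apply: deriv_lip => //; first exact: rf_M f_reg.
apply: ae_sub yd' => s hs ts; exists (f (y s) (u s)); first exact: hs.
apply: (rf_bnd f_reg); apply: uc'.1.
by case/andP: ts => /ltW -> /ltW ->.
Qed.

(** The second component, which starts at [z] and decreases at the rate of the
    running cost, ends at [z] minus the total cost: this couples the state with the
    objective and turns the control problem into a field on the product space. *)
Lemma solution_of_control t x z u : 0 <= t <= T -> control_on U 0 T u ->
  exists W, [/\ solution_on g M t T u W, W t = (x, z),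
    (W T).2 = z - cost T f L t x u & lip_on t T ML (fun s => (W s).2)].
Proof.
move=> tT uc; have [yt yl yd] := trajectoryP x tT uc.
set y := trajectory T f t x u in yt yl yd.
case/andP: (tT) => t0 tT'.
have uc' : control_on U t T u by exact: control_sub uc.
have [P0 Pl Pd] := primitiveP tT' L_reg uc' yl.
have zl : lip_on t T ML (fun s => z - primitive L t y u s).
  move=> r s hr hs; apply: le_trans (Pl r s hr hs).
  by rewrite opprB addrC addrA subrK distrC.
exists (fun s => (y s, z - primitive L t y u s)); split => //.
- split.
    apply: lip_pair.
      by apply: lip_le yl; rewrite le_max lexx.
    by apply: lip_le zl; rewrite le_max lexx orbT.
  have := ae_and yd Pd; apply: ae_sub => s [h1 h2] ts.
  apply: has_deriv_pair; first exact: h1.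
  rewrite -[X in has_deriv _ _ X]sub0r.
  by apply: has_derivB (h2 ts); exact: has_deriv_cst.
- by rewrite yt P0 subr0.
Qed.

Lemma return_function_below t x z : 0 <= t <= T ->
  closure (objective_space T U f L t x) z ->
  exists2 v, return_function T U f L t x v & orthant (z - v).
Proof.
move=> tT; apply: pareto_below.
case/andP: (tT) => t0 tT'.
apply: bounded_closed_compact; last exact: closed_closure.
exists (ML * (T - t)); split; first exact: num_real.
move=> B MB y /closure_normP cy; apply/ler_addgt0Pr => e e0.
have [_ [u /controlsP uc <-] yu] := cy e e0.
have [W [_ Wt WT Wl]] := solution_of_control x 0 tT uc.
have := Wl T t; rewrite !lexx tT' => /(_ isT isT).
rewrite WT Wt/= subr0 sub0r normrN ger0_norm ?subr_ge0// => h.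
rewrite -(subrK (cost T f L t x u) y) addrC.
apply: le_trans (ler_normD _ _) _; apply: lerD; last exact: ltW.
exact: le_trans h (ltW MB).
Qed.

(** A point of the return function is a limit of costs. The trajectories of
    controls whose costs converge to it have a relaxed limit whose second component
    ends at the slack [w0 >= 0]. Stopped at time [T], that limit is viable: before
    [T] its second component can fall by at most [ML] per unit of time, which keeps
    it above the lower boundary of the constraint set. *)
Lemma epi_sub_viab : epi_return T U f L `<=`
  viability_kernel (expanded_map T U f L) (@constraint_set R n p T ML).
Proof.
move=> [t [x z]] [/=]; rewrite in_itv/= => tT [v [Sv _] [w0 w00 zE]].
have tT' : t <= T by case/andP: tT.
have t0 : 0 <= t by case/andP: tT.
have ttT : t <= t <= T by rewrite lexx.
have tTT : t <= T <= T by rewrite lexx tT'.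
have /choice[u uP] : forall k : nat, exists u, control_on U 0 T u /\
    `|v - cost T f L t x u| < 1 / 2 ^+ k.
  move=> k; have k0 : 0 < 1 / 2 ^+ k :> R by rewrite divr_gt0// exprn_gt0.
  move/closure_normP: Sv => /(_ _ k0)[_ [u /controlsP uc <-] vu].
  by exists u.
have /choice[W WP] : forall k, exists W, [/\ solution_on g M t T (u k) W,
    W t = (x, z), (W T).2 = z - cost T f L t x (u k) &
    lip_on t T ML (fun s => (W s).2)].
  by move=> k; apply: solution_of_control => //; have [] := uP k.
have [G GU GN] := ultrafilter_nat.
have uc k : control_on U t T (u k) by apply: control_sub (uP k).1.
have Ws k : solution_on g M t T (u k) (W k) by have [] := WP k.
have Wt k : W k t = (x, z) by have [] := WP k.
have [w wr wlim] := solutions_compact K0 M0 expanded_velocity_lip U_neq0 GU GN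
  tT' uc Ws Wt.
have wt : w t = (x, z).
  apply/eqP; rewrite -subr_eq0 -normr_le0.
  apply: (@ulim_le _ _ GU _ _ (fun=> (x, z)) _ _ _ 0%N (wlim _ ttT)) => //.
    exact: ulim_cst.
  by move=> k _; rewrite Wt subrr normr0.
have zlim r : t <= r <= T -> ulim G (fun k => (W k r).2) (w r).2.
  move=> hr e e0; apply: filterS (wlim r hr e e0) => k /=; apply: le_lt_trans.
  exact: (norm_snd_le (W k r - w r)).
have wT : (w T).2 = w0.
  have -> : w0 = z - v by rewrite -zE addrC addKr.
  apply/eqP; rewrite -subr_eq0 -normr_le0.
  apply: (@le0_halving _ 1) => N.
  apply: (@ulim_le _ _ GU _ _ (fun=> z - v) _ _ _ N (zlim _ tTT)) => //.
    exact: ulim_cst.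
  move=> k Nk; have [_ _ -> _] := WP k; have [_ vu] := uP k.
  rewrite opprD opprK addrACA subrr add0r addrC; apply: le_trans (ltW vu) _.
  rewrite !div1r lef_pV2 ?posrE ?exprn_gt0//.
  by apply: ler_weXn2l => //; rewrite ler1n.
have zl r : t <= r <= T -> `|(w r).2 - w0| <= ML * (T - r).
  move=> hr; rewrite -wT -[X in `|X|]subr0.
  apply: (@ulim_le _ _ GU _ _ (fun=> 0) _ _ _ 0%N (ulimB GU (zlim r hr) (zlim T tTT))) => //.
    exact: ulim_cst.
  move=> k _; rewrite subr0; have [_ _ _ Wl] := WP k.
  apply: le_trans (Wl r T hr tTT) _.
  by case/andP: hr => _ rT; rewrite distrC ger0_norm ?subr_ge0.
have H r : t <= r <= T -> constraint_set T ML (r, w r).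
  move=> hr; split; rewrite /=.
    by rewrite in_itv/=; case/andP: hr => tr ->; rewrite (le_trans t0).
  exists ((w r).2 + ((T - r) * ML) *: const_mx 1).
    move=> j; rewrite !mxE mulr1.
    have := norm_rV_coord ((w r).2 - w0) j; rewrite !mxE => h.
    have := le_trans h (zl r hr); rewrite ler_norml => /andP[h1 _].
    have := w00 j; lra.
  by rewrite addrCA scaleNr addNr addr0.
have cl := clamp_itv tT'.
(* Clamping stops the curve at time [T]. *)
pose om s := (clamp t T (t + s), w (clamp t T (t + s))).
have om0 : om 0 = (t, (x, z)) by rewrite /om addr0 clampE// wt.
split; first by rewrite -om0; exact/H.
exists om; split.
- exact: om0.
- move=> b b0.
  have sE (r s : R) : (t + r) - (t + s) = r - s by rewrite opprD addrACA subrr add0r.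
  apply: (@lip_ac _ _ _ _ (Num.max 1 M)); apply: lip_pair => r s _ _.
    have h := @clamp_lip _ t T (t + r) (t + s); rewrite sE in h.
    apply: (le_trans h).
    by rewrite -[leLHS]mul1r ler_wpM2r// le_max lexx.
  have h := lip_clamp tT' M0 wr.1 (t + r) (t + s); rewrite sE in h.
  apply: (le_trans h).
  by rewrite ler_wpM2r// le_max lexx orbT.
- have := ae_and (ae_and (ae_neq 0) (ae_neq (T - t))) (ae_shift t wr.2).
  apply: ae_sub => s [[s0 sT] hs] s_ge0.
  have s_gt0 : 0 < s by rewrite lt_neqAle s_ge0 andbT eq_sym; exact/eqP.
  have [tsT|Tts] := ltP (t + s) T.
    have [|v' wv' cv'] := hs; first by rewrite tsT andbT ltrDl.
    have ts : t <= t + s <= T by rewrite lerDl s_ge0 ltW.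
    exists ((1 : R), v').
      apply/has_derivP.
      apply: (@has_deriv_itv _ _ (fun r => (t + r, w (t + r))) om 0 (T - t)).
      - by rewrite s_gt0 ltrBrDl.
      - move=> r /andP[r0 rT]; rewrite /om clampE// lerDl r0/=.
        by rewrite -lerBrDl.
      apply: has_deriv_pair; last exact: has_deriv_shift.
      by apply: has_derivD_cst; exact: has_deriv_id.
    rewrite /expanded_map /om/= clampE// tsT; split => //=.
    by rewrite FLminusE.
  have Ts : T - t < s by rewrite lt_neqAle eq_sym lerBlDl Tts andbT; exact/eqP.
  (* After time [T] the curve rests, which the map allows there. *)
  exists ((0 : R), (0, 0)).
    apply/has_derivP.
    apply: (@has_deriv_itv _ _ (fun=> (T, w T)) om (T - t) (s + 1)).
    - by rewrite Ts/= ltrDl ltr01.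
    - move=> r /andP[Tr _]; rewrite /om.
      have -> : clamp t T (t + r) = T; last by [].
      rewrite /clamp (min_idPr _); last by rewrite -lerBlDl.
      exact/max_idPr.
    exact: has_deriv_cst.
  have omT : om s = (T, w T).
    rewrite /om; have -> : clamp t T (t + s) = T; last by [].
    by rewrite /clamp (min_idPr Tts); exact/max_idPr.
  rewrite /expanded_map omT/= ltxx; split => /=.
    by rewrite in_itv/= lexx ler01.
  by apply: subset_closure; apply: sub_hull; right.
- by move=> s s0; exact: H.
Qed.

(** Along a viable curve the time component advances at unit speed until it
    reaches [T]. Up to then the curve is relaxed, and by relaxation some controls
    have costs arbitrarily close to the total decrease of the second component. As
    that component is nonnegative at time [T], the point [z] lies above a limit of
    costs, and hence above an efficient one. *)
Lemma viab_sub_epi :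
  viability_kernel (expanded_map T U f L) (@constraint_set R n p T ML) `<=`
  epi_return T U f L.
Proof.
move=> [t [x z]] [[/= tT _] [w [w0 wac dw wH]]].
rewrite in_itv/= in tT.
have tT' : t <= T by case/andP: tT.
have t0 : 0 <= t by case/andP: tT.
pose S := T - t.
have S0 : 0 <= S by rewrite subr_ge0.
have tau0 : (w 0).1 = t by rewrite w0.
have tau_ac (s : R) : 0 <= s -> absolutely_continuous 0 s (fun r => (w r).1).
  move=> s0; apply: ac_image (wac s s0) => r q; exact: (norm_fst_le (w r - w q)).
have phi_itv q v : expanded_map T U f L q v -> 0 <= v.1 <= 1.
  rewrite /expanded_map; case: ifP => _ [/=]; first by move=> -> _; rewrite ler01 lexx.
  by rewrite in_itv.
have tau_le (s : R) : 0 <= s -> (w s).1 <= t + s.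
  (* Time has its speed in [0, 1], the ball of radius 1/2 about 1/2. *)
  move=> s0; have : `|(w s).1 - (w 0).1 - (s - 0) *: (1 / 2 : R)| <= 1 / 2 * (s - 0).
    apply: (@mean_value_ball _ _ 0 s (fun r => (w r).1)) => //; first exact: tau_ac.
    apply: ae_sub dw => r hr /andP[r0 rs]; have [v /has_derivP wv pv] := hr (ltW r0).
    exists v.1; first exact: has_deriv_fst wv.
    by have /andP[v0 v1] := phi_itv _ _ pv; rewrite ler_norml; apply/andP; split; lra.
  by rewrite tau0 subr0 /GRing.scale/= ler_norml => /andP[_]; lra.
have tau_eq (s : R) : 0 <= s <= S -> (w s).1 = t + s.
  move=> /andP[s0 sS]; have : `|(w s).1 - (w 0).1 - (s - 0) *: (1 : R)| <= 0 * (s - 0).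
    apply: (@mean_value_ball _ _ 0 s (fun r => (w r).1)) => //; first exact: tau_ac.
    apply: ae_sub dw => r hr /andP[r0 rs]; have [v /has_derivP wv pv] := hr (ltW r0).
    exists v.1; first exact: has_deriv_fst wv.
    move: pv; rewrite /expanded_map ifT; first by case=> /= -> _; rewrite subrr normr0.
    apply: le_lt_trans (tau_le r (ltW r0)) _.
    by rewrite -ltrBrDl; exact: lt_le_trans sS.
  by rewrite tau0 mul0r subr0 normr_le0 /GRing.scale/= mulr1 => /eqP; lra.
have dw2 : {ae mu, forall s, 0 < s < S -> exists2 v,
    has_deriv (fun r => (w r).2) s v & FLminus U f L (w s).2.1 v}.
  apply: ae_sub dw => s hs /andP[s_gt0 sS].
  have [v /has_derivP wv pv] := hs (ltW s_gt0).
  exists v.2; first exact: has_deriv_snd wv.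
  move: pv; rewrite /expanded_map ifT; first by case.
  by rewrite tau_eq ?(ltW s_gt0) ?ltW//= -ltrBrDl.
have w2l : lip_on 0 S M (fun r => (w r).2).
  apply: deriv_lip => //.
    by apply: ac_image (wac S S0) => r q; exact: (norm_snd_le (w r - w q)).
  apply: ae_sub dw2 => s hs /hs[v wv cv]; exists v => //; exact: FLminus_bnd cv.
pose W r := (w (r - t)).2.
have Wr : relaxed_on U g M t T W.
  split.
    move=> r s /andP[tr rT] /andP[ts sT]; rewrite /W.
    have -> : r - s = (r - t) - (s - t) by ring.
    by apply: w2l; rewrite subr_ge0 ?tr ?ts lerD2r.
  have := ae_shift (- t) dw2; apply: ae_sub => s hs /andP[ts sT].
  have [|v wv cv] := hs; first by rewrite addrC subr_gt0 ts ltrD2r.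
  exists v; last by rewrite -FLminusE /W addrC.
  have WE : (fun r => (w (- t + r)).2) = W by apply/funext => r; rewrite /W addrC.
  by have : has_deriv (fun r => (w (- t + r)).2) s v := has_deriv_shift wv;
    rewrite WE.
have WT : orthant (W T).2.
  have [/= _ [q q0 qE]] := wH S S0.
  have tauS : (w S).1 = T by rewrite tau_eq ?S0 ?lexx// /S addrC subrK.
  have qS : (w S).2.2 = q by rewrite -qE tauS subrr mul0r oppr0 scale0r add0r.
  by move=> j; rewrite /W -/S qS; exact: q0.
have clY : closure (objective_space T U f L t x) (z - (W T).2).
  apply/closure_normP => e e0; have e2 : 0 < e / 2 by rewrite divr_gt0.
  have [u ctl uP] := relaxation K0 M0 expanded_velocity_lip U_neq0 tT' e2 Wr.
  have [v Uv] := U_neq0.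
  pose u' s := if s < t then v else u s.
  have uc : control_on U 0 T u' by apply: control_cat => //; exact: control_cst.
  have [V [Vs Vt VT _]] := solution_of_control x z tT uc.
  have Vs' : solution_on g M t T u V.
    apply: solution_eq_control Vs => s /andP[ts _].
    by rewrite /u' ltNge (ltW ts).
  have Vw : V t = W t by rewrite Vt /W subrr w0.
  have VW := uP V Vs' Vw.
  exists (cost T f L t x u'); first by exists u' => //; exact/controlsP.
  apply: (@le_lt_trans _ _ `|V T - W T|); last by apply: le_lt_trans VW _; lra.
  apply: le_trans (norm_snd_le _); rewrite /= VT.
  by rewrite addrAC.
have [v Vv zv] := return_function_below tT clY.
split; first by rewrite /= in_itv.
exists v => //; exists (z - v); last by rewrite addrC subrK.
move=> j; have := zv j; have := WT j; rewrite !mxE; lra.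
Qed.

End ControlProblem.

Theorem proposition4p1 (R : realType) (n m p : nat) (T : R)
    (U : set 'rV[R]_m)
    (f : 'rV[R]_n -> 'rV[R]_m -> 'rV[R]_n)
    (L : 'rV[R]_n -> 'rV[R]_m -> 'rV[R]_p)
    (Kf Mf KL ML : R)
    (T_gt0 : 0 < T)
    (U_neq0 : U !=set0) (U_compact : compact U)
    (f_cont : {within [set: 'rV[R]_n] `*` U,
       continuous (fun xu : 'rV[R]_n * 'rV[R]_m => f xu.1 xu.2)})
    (Kf_gt0 : 0 < Kf) (Mf_gt0 : 0 < Mf)
    (f_lip : forall x1 x2 u, U u -> `|f x1 u - f x2 u| <= Kf * `|x1 - x2|)
    (f_bnd : forall x u, U u -> `|f x u| <= Mf)
    (L_cont : {within [set: 'rV[R]_n] `*` U,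
       continuous (fun xu : 'rV[R]_n * 'rV[R]_m => L xu.1 xu.2)})
    (KL_ge0 : 0 <= KL) (ML_ge0 : 0 <= ML)
    (L_lip : forall x1 x2 u, U u -> `|L x1 u - L x2 u| <= KL * `|x1 - x2|)
    (L_bnd : forall x u, U u -> `|L x u| <= ML) :
  epi_return T U f L =
  viability_kernel (expanded_map T U f L) (@constraint_set R n p T ML).
Proof.
have f_reg : regular_field U f Kf Mf by split => //; exact: ltW.
have L_reg : regular_field U L KL ML by split.
apply/seteqP; split.
  exact: (epi_sub_viab f_reg L_reg U_neq0 U_compact).
exact: (viab_sub_epi f_reg L_reg U_neq0 U_compact).
Qed.
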